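(* Let $K$ be a field of characteristic $p>0$ containing a primitive $m$th root of unity, where $m>1$ and $p\nmid m$, and let $n\ge1$ with $p\mid n$. Let $G=G(m,m,n)$, take $\hbar=0$ and generic parameters, and let $J\subset A=K[x_1,\dots,x_n]$ be the unique maximal proper graded submodule of the Verma module $M(\mathrm{triv})=A$ of the rational Cherednik algebra $\mathbf{H}(G)$. Then $J$ is the ideal generated by the differences $x_a^m-x_b^m$ ($1\le a<b\le n$) and the squarefree monomials of degree $p$ in $x_1,\dots,x_n$.
   Context: $G(m,m,n)$ is the group of $n\times n$ monomial matrices over $K$ whose nonzero entries are $m$th roots of unity with product $1$, acting on $\mathfrak{h}=K^n$ and $\mathfrak{h}^*$ (dual coordinate bases $y_1,\dots,y_n$ and $x_1,\dots,x_n$). Its reflections (finite-order elements $s$ with $\operatorname{rank}(1-s)=1$) are $s_{ij}^k$ ($i<j$, $0\le k<m$): $x_i\mapsto\xi^kx_j$, $x_j\mapsto\xi^{-k}x_i$, other $x_\ell$ fixed, with $\xi$ a primitive $m$th root of unity. For a reflection $s$ choose $\alpha_s\in\mathfrak{h}^*$ spanning the image of $1-s$ and $\alpha_s^\vee\in\mathfrak{h}$ with $(1-s)x=(\alpha_s^\vee,x)\alpha_s$; let $c_s\in K$ depend only on the conjugacy class of $s$. Generic means the $c_s$ (one per conjugacy class of reflections) are algebraically independent over the prime field. $\mathbf{H}(G)$ ($\hbar=0$) is the quotient of $K[G]\ltimes T(\mathfrak{h}\oplus\mathfrak{h}^* )$ by $[x,x']=0$, $[y,y']=0$, $[y,x]=-\sum_sc_s(y,\alpha_s)(x,\alpha_s^\vee)s$,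 graded by $\deg x=1$, $\deg y=-1$, $\deg g=0$. Its Verma module for the trivial representation is $A=\mathrm{Sym}(\mathfrak{h}^* )=K[x_1,\dots,x_n]$, with $A$ acting by multiplication, $G$ naturally, and $y\in\mathfrak{h}$ by the Dunkl operator $D_yf=-\sum_sc_s\frac{(y,\alpha_s)}{\alpha_s}(1-s)f$. *)

(* Defs.v *)
From HB Require Import structures.
From mathcomp Require Import all_boot fingroup perm all_algebra.
From mathcomp Require Import mpoly.

Set Implicit Arguments.
Unset Strict Implicit.
Unset Printing Implicit Defensive.

Import GRing.Theory.
Local Open Scope ring_scope.

(* Conventions: h = 'cV[K]_n and h^* = 'rV[K]_n; a matrix g acts on h by
   y |-> g *m y and on h^* by the contragredient action x |-> x *m invmx g.
   The coordinate basis x_i of h^* is the family of variables 'X_i of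
   Sym h^* = {mpoly K[n]}. *)

Section MatrixGroups.
Variables (K : fieldType) (n : nat).

Record matgroup := Matgroup {
  mg_elts :> seq 'M[K]_n;
  mg_unit : forall g, g \in mg_elts -> g \in unitmx;
  mg_one : 1%:M \in mg_elts;
  mg_mul : forall g h, g \in mg_elts -> h \in mg_elts -> g *m h \in mg_elts;
  mg_inv : forall g, g \in mg_elts -> invmx g \in mg_elts }.

Definition pairing (y : 'cV[K]_n) (x : 'rV[K]_n) : K := (x *m y) 0 0.

Definition dual_act (g : 'M[K]_n) (x : 'rV[K]_n) : 'rV[K]_n := x *m invmx g.

Definition linform (x : 'rV[K]_n) : {mpoly K[n]} := \sum_(i < n) x 0 i *: 'X_i.

(* The algebra automorphism of Sym h^* extending the action on h^*. *)
Definition poly_act (g : 'M[K]_n) (f : {mpoly K[n]}) : {mpoly K[n]} :=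
  f \mPo [tuple linform (dual_act g (delta_mx 0 i)) | i < n].

(* In a finite group every element has finite order. *)
Definition is_reflection (s : 'M[K]_n) : bool := \rank (1%:M - s) == 1%N.

Definition reflection (G : matgroup) : finType :=
  seq_sub [seq s <- mg_elts G | is_reflection s].

Definition conjugate (G : matgroup) (s t : reflection G) : Prop :=
  exists2 g, g \in mg_elts G & val t = g *m val s *m invmx g.

(* The parameters c_s, and a choice of alpha_s (root) and alpha_s^vee (coroot);
   here 1 - s is the endomorphism x |-> x - dual_act s x of h^*. *)
Record cherednik_datum (G : matgroup) := CherednikDatum {
  param : reflection G -> K;
  param_conj : forall s t, conjugate s t -> param s = param t;
  root : reflection G -> 'rV[K]_n;
  root_span : forall s, (root s == 1%:M - invmx (val s))%MS;
  coroot : reflection G -> 'cV[K]_n;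
  coroot_spec : forall s x,
    x - dual_act (val s) x = pairing (coroot s) x *: root s }.

(* In positive characteristic the prime field is {k%:R | k : nat}.  The family
   of parameters is indexed by conjugacy classes, hence the restriction to
   pairwise non-conjugate reflections. *)
Definition generic (G : matgroup) (D : cherednik_datum G) : Prop :=
  forall (r : nat) (s : 'I_r -> reflection G),
    (forall i j, conjugate (s i) (s j) -> i = j) ->
  forall P : {mpoly K[r]},
    (forall u, exists k : nat, P@_u = k%:R) ->
    P.@[fun i => param D (s i)] = 0 -> P = 0.

End MatrixGroups.

Section CherednikModules.
Variables (K : fieldType) (n : nat) (G : matgroup K n) (D : cherednik_datum G).

(* H(G) (at hbar = 0) is the algebra generated by G, h and h^* subject to the
   relations below, so an H(G)-module is a vector space V with operators for
   these generators satisfying these relations. *)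
Record cherednik_module (V : lmodType K) := CherednikModule {
  opG : 'M[K]_n -> V -> V;
  opX : 'rV[K]_n -> V -> V;
  opY : 'cV[K]_n -> V -> V;
  opG_linear : forall g, g \in mg_elts G -> linear (opG g);
  opX_linear : forall x, linear (opX x);
  opY_linear : forall y, linear (opY y);
  opX_linearl : forall u, linear (fun x => opX x u);
  opY_linearl : forall u, linear (fun y => opY y u);
  opG1 : forall u, opG 1%:M u = u;
  opGM : forall g h u, g \in mg_elts G -> h \in mg_elts G ->
    opG (g *m h) u = opG g (opG h u);
  opGX : forall g x u, g \in mg_elts G ->
    opG g (opX x u) = opX (dual_act g x) (opG g u);
  opGY : forall g y u, g \in mg_elts G ->
    opG g (opY y u) = opY (g *m y) (opG g u);
  opXC : forall x x' u, opX x (opX x' u) = opX x' (opX x u);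
  opYC : forall y y' u, opY y (opY y' u) = opY y' (opY y u);
  opYX : forall y x u, opY y (opX x u) - opX x (opY y u) =
    - \sum_(s : reflection G)
        (param D s * pairing y (root D s) * pairing (coroot D s) x)
          *: opG (val s) u }.

Record is_submodule (V : lmodType K) (M : cherednik_module V) (N : V -> Prop) :
    Prop := IsSubmodule {
  sub_zero : N 0;
  sub_linear : forall a u v, N u -> N v -> N (a *: u + v);
  sub_G : forall g u, g \in mg_elts G -> N u -> N (opG M g u);
  sub_X : forall x u, N u -> N (opX M x u);
  sub_Y : forall y u, N u -> N (opY M y u) }.

End CherednikModules.

Section Graded.
Variables (K : fieldType) (n : nat) (G : matgroup K n) (D : cherednik_datum G).
Variable M : cherednik_module D {mpoly K[n]}.

Definition proper_graded_submodule (N : {mpoly K[n]} -> Prop) : Prop :=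
  [/\ is_submodule M N,
      forall d f, N f -> N (pihomog mdeg d f)
    & exists f, ~ N f].

Definition maximal_proper_graded_submodule (N : {mpoly K[n]} -> Prop) : Prop :=
  proper_graded_submodule N /\
  forall N', proper_graded_submodule N' ->
    (forall f, N f -> N' f) -> forall f, N' f -> N f.

End Graded.

Definition ideal_generated (A : comNzRingType) (S : A -> Prop) (f : A) : Prop :=
  exists2 l : seq (A * A),
    forall q, q \in l -> S q.2 & f = \sum_(q <- l) q.1 * q.2.

(******************************************************************************)

Section PolyAction.
Variables (K : fieldType) (n : nat).
Implicit Types (g h : 'M[K]_n) (x : 'rV[K]_n) (f : {mpoly K[n]}).

Lemma linform_is_linear : linear (@linform K n).
Proof.
move=> a x y; rewrite /linform scaler_sumr -big_split /=.
by apply: eq_bigr => i _; rewrite !mxE scalerDl scalerA.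
Qed.

HB.instance Definition _ :=
  GRing.isLinear.Build K 'rV[K]_n {mpoly K[n]} _ (@linform K n) linform_is_linear.

HB.instance Definition _ g := GRing.RMorphism.copy (poly_act g)
  (comp_mpoly [tuple linform (dual_act g (delta_mx 0 i)) | i < n]).
HB.instance Definition _ g := GRing.Linear.copy (poly_act g)
  (comp_mpoly [tuple linform (dual_act g (delta_mx 0 i)) | i < n]).

Lemma linform_delta i : linform (delta_mx 0 i) = 'X_i :> {mpoly K[n]}.
Proof.
rewrite /linform (bigD1 i) //= mxE !eqxx scale1r big1 ?addr0 // => j ne_ji.
by rewrite mxE eqxx (negbTE ne_ji) scale0r.
Qed.

Lemma linform_eq0 x : linform x = 0 -> x = 0.
Proof.
move=> x0; apply/rowP => i; rewrite mxE.
have := congr1 (mcoeff U_(i)) x0.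
rewrite mcoeff0 /linform linear_sum /= (bigD1 i) //= big1 => [|j ne_ji].
  by rewrite addr0 linearZ /= mcoeffXU eqxx mulr1.
by rewrite linearZ /= mcoeffXU (negbTE ne_ji) mulr0.
Qed.

Lemma poly_actX g i : poly_act g 'X_i = linform (dual_act g (delta_mx 0 i)).
Proof. by rewrite /poly_act comp_mpolyXU -tnth_nth tnth_mktuple. Qed.

Lemma dual_act_is_linear g : linear (dual_act g).
Proof. by move=> a x y; rewrite /dual_act mulmxDl scalemxAl. Qed.

HB.instance Definition _ g :=
  GRing.isLinear.Build K 'rV[K]_n 'rV[K]_n _ (dual_act g) (dual_act_is_linear g).

Lemma poly_act_linform g x : poly_act g (linform x) = linform (dual_act g x).
Proof.
rewrite [x in RHS]row_sum_delta !linear_sum /=.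
by apply: eq_bigr => i _; rewrite !linearZ /= poly_actX.
Qed.

Lemma mpoly_algind (P : {mpoly K[n]} -> Prop) :
  P 1 -> (forall a f (q : {mpoly K[n]}), P f -> P q -> P (a *: f + q)) ->
  (forall i f, P f -> P ('X_i * f)) -> forall f, P f.
Proof.
move=> P1 PD PX f.
have P0 : P 0 by rewrite -(subrr 1) addrC -scaleN1r; apply: PD.
have Pm m : P 'X_[m].
  rewrite mpolyXE_id; elim/big_rec: _ => // i q _ Pq.
  by elim: (m i) => [|k IHk]; rewrite ?expr0 ?mul1r // exprS -mulrA; apply: PX.
elim/mpolyind: f => [|c m f _ _ Pf]; first exact: P0.
exact: PD.
Qed.

Lemma mpoly_linind (P : {mpoly K[n]} -> Prop) :
  P 1 -> (forall a f (q : {mpoly K[n]}), P f -> P q -> P (a *: f + q)) ->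
  (forall x f, P f -> P (linform x * f)) -> forall f, P f.
Proof.
move=> P1 PD PX; apply: mpoly_algind => // i f Pf.
by rewrite -linform_delta; apply: PX.
Qed.

Lemma poly_act1 f : poly_act 1%:M f = f.
Proof.
elim/mpoly_linind: f => [|a f h IHf IHh|x f IHf].
- exact: rmorph1.
- by rewrite linearP /= IHf IHh.
- by rewrite rmorphM /= IHf poly_act_linform /dual_act invmx1 mulmx1.
Qed.

Lemma poly_actM g h f : g \in unitmx -> h \in unitmx ->
  poly_act (g *m h) f = poly_act g (poly_act h f).
Proof.
move=> Ug Uh; elim/mpoly_linind: f => [|a f k IHf IHk|x f IHf].
- by rewrite !rmorph1.
- by rewrite !linearP /= IHf IHk.
rewrite !rmorphM /= IHf !poly_act_linform; congr (linform _ * _).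
rewrite /dual_act -mulmxA; congr (_ *m _).
have Ugh : g *m h \in unitmx by rewrite unitmx_mul Ug.
apply: (can_inj (mulKmx Ugh)); rewrite mulmxV //.
by rewrite mulmxA -(mulmxA g) mulmxV // mulmx1 mulmxV.
Qed.

End PolyAction.

Section Dunkl.
Variables (K : fieldType) (n : nat) (G : matgroup K n) (D : cherednik_datum G).
Implicit Types (s t : reflection G) (x : 'rV[K]_n) (y z : 'cV[K]_n).
Implicit Types (f : {mpoly K[n]}).

Let Gunit g : g \in mg_elts G -> g \in unitmx := @mg_unit K n G g.

Lemma reflG s : val s \in mg_elts G.
Proof. by have := valP s; rewrite mem_filter => /andP[]. Qed.

Lemma refl_rank s : \rank (1%:M - val s) = 1%N.
Proof. by have := valP s; rewrite mem_filter => /andP[/eqP]. Qed.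

Lemma root_divides s f :
  exists q, linform (root D s) * q == f - poly_act (val s) f.
Proof.
elim/mpoly_linind: f => [|a f h [qf /eqP Ef] [qh /eqP Eh]|x f [q /eqP Eq]].
- by exists 0; rewrite mulr0 rmorph1 subrr.
- exists (a *: qf + qh); rewrite linearP /= mulrDr -scalerAr Ef Eh.
  by rewrite scalerBr opprD addrACA.
- exists (linform x * q + pairing (coroot D s) x *: poly_act (val s) f).
  rewrite mulrDr mulrCA Eq -scalerAr scalerAl -linearZ /= -coroot_spec.
  by rewrite rmorphM /= poly_act_linform linearB /= mulrBr mulrBl addrA subrK.
Qed.

(* The polynomial (1 - s) f / alpha_s. *)
Definition divided_difference s f : {mpoly K[n]} := xchoose (root_divides s f).

Definition dunkl y f : {mpoly K[n]} :=
  - \sum_(s : reflection G)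
      (param D s * pairing y (root D s)) *: divided_difference s f.

Lemma divided_differenceE s f :
  linform (root D s) * divided_difference s f = f - poly_act (val s) f.
Proof. exact/eqP/(xchooseP (root_divides s f)). Qed.

Lemma root_corootE s :
  1%:M - invmx (val s) = coroot D s *m root D s.
Proof.
apply/row_matrixP => i; rewrite !rowE mulmxA mulmxBr mulmx1.
have := coroot_spec D s (delta_mx 0 i); rewrite /dual_act /pairing => ->.
by rewrite [X in X *m root D s]mx11_scalar mul_scalar_mx.
Qed.

Lemma root_neq0 s : root D s != 0.
Proof.
apply/eqP => r0; have := root_corootE s; rewrite r0 mulmx0 => /eqP.
rewrite subr_eq0 => /eqP E; have := refl_rank s.
by rewrite -(invmxK (val s)) -E invmx1 subrr mxrank0.
Qed.

Lemma linroot_neq0 s : linform (root D s) != 0.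
Proof. by apply/eqP => /linform_eq0/eqP; apply/negP/root_neq0. Qed.

Lemma divided_difference_uniq s f q :
  linform (root D s) * q = f - poly_act (val s) f -> divided_difference s f = q.
Proof.
by move=> E; apply: (mulfI (linroot_neq0 s)); rewrite divided_differenceE E.
Qed.

Lemma divided_difference_is_linear s : linear (divided_difference s).
Proof.
move=> a f h; apply: divided_difference_uniq.
by rewrite mulrDr -scalerAr !divided_differenceE linearP /= scalerBr opprD addrACA.
Qed.

Lemma divided_difference_mull s x f :
  divided_difference s (linform x * f) =
  linform x * divided_difference s f
  + pairing (coroot D s) x *: poly_act (val s) f.
Proof.
apply: divided_difference_uniq.
rewrite mulrDr mulrCA divided_differenceE -scalerAr scalerAl -linearZ /=.
rewrite -coroot_spec.
by rewrite rmorphM /= poly_act_linform linearB /= mulrBr mulrBl addrA subrK.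
Qed.

Lemma dunkl_is_linear y : linear (dunkl y).
Proof.
move=> a f h; rewrite /dunkl scalerN -opprD scaler_sumr -big_split /=.
congr (- _); apply: eq_bigr => s _.
by rewrite divided_difference_is_linear scalerDr !scalerA mulrC.
Qed.

HB.instance Definition _ y :=
  GRing.isLinear.Build K {mpoly K[n]} {mpoly K[n]} _ (dunkl y)
    (dunkl_is_linear y).

Lemma pairing_linear x : linear_for *%R (fun y => pairing y x).
Proof.
by move=> a y z; rewrite /pairing mulmxDr -scalemxAr !mxE.
Qed.

Lemma dunkl_is_linearl f : linear (fun y => dunkl y f).
Proof.
move=> a y z; rewrite /dunkl scalerN -opprD scaler_sumr -big_split /=.
congr (- _); apply: eq_bigr => s _.
by rewrite pairing_linear mulrDr scalerDl scalerA mulrCA.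
Qed.

Lemma dunkl1 y : dunkl y 1 = 0.
Proof.
rewrite /dunkl big1 ?oppr0 // => s _.
by rewrite (@divided_difference_uniq s 1 0) ?scaler0 // mulr0 rmorph1 subrr.
Qed.

Lemma dunkl_mull y x f :
  dunkl y (linform x * f) = linform x * dunkl y f
  - \sum_(s : reflection G)
     (param D s * pairing y (root D s) * pairing (coroot D s) x)
       *: poly_act (val s) f.
Proof.
rewrite /dunkl mulrN -opprD mulr_sumr -big_split /=; congr (- _).
apply: eq_bigr => s _.
by rewrite divided_difference_mull scalerDr -scalerAr scalerA.
Qed.

Lemma conj_refl_subproof g s : g \in mg_elts G ->
  g *m val s *m invmx g \in [seq s <- mg_elts G | is_reflection s].
Proof.
move=> Gg; have Ug := Gunit Gg; rewrite mem_filter; apply/andP; split; last first.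
  by rewrite !mg_mul ?mg_inv ?reflG.
rewrite /is_reflection; apply/eqP; rewrite -[RHS](refl_rank s).
have -> : 1%:M - g *m val s *m invmx g = g *m (1%:M - val s) *m invmx g.
  by rewrite mulmxBr mulmxBl mulmx1 mulmxV.
rewrite mxrankMfree ?row_free_unit ?unitmx_inv //.
by rewrite -[LHS]mxrank_tr trmx_mul mxrankMfree ?mxrank_tr // row_free_unit unitmx_tr.
Qed.

Definition conj_refl g (Gg : g \in mg_elts G) s : reflection G :=
  SeqSub (conj_refl_subproof s Gg).

Lemma conj_refl_bij g (Gg : g \in mg_elts G) : bijective (conj_refl Gg).
Proof.
apply: injF_bij => s t /(congr1 val) /= E; apply: val_inj => /=.
have Ug := Gunit Gg.
by have := congr1 (fun M => invmx g *m (M *m g)) E; rewrite !mulmxKV // !mulKmx.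
Qed.

Lemma invmx_conj (g h : 'M[K]_n) : g \in unitmx -> h \in unitmx ->
  invmx (g *m h *m invmx g) = g *m invmx h *m invmx g.
Proof.
move=> Ug Uh; have U : g *m h *m invmx g \in unitmx.
  by rewrite !unitmx_mul Ug Uh unitmx_inv.
apply: (can_inj (mulKmx U)); rewrite mulmxV // !mulmxA mulmxKV //.
by rewrite mulmxK // mulmxV.
Qed.

Lemma root_conj g (Gg : g \in mg_elts G) s :
  exists2 a, a != 0 & root D (conj_refl Gg s) = a *: dual_act g (root D s).
Proof.
have Ug := Gunit Gg; set t := conj_refl Gg s.
have Et : 1%:M - invmx (val t) = (g *m coroot D s) *m dual_act g (root D s).
  rewrite /= invmx_conj ?Gunit ?reflG // /dual_act mulmxA -(mulmxA g (coroot D s)).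
  by rewrite -root_corootE mulmxBr mulmxBl mulmx1 mulmxV.
have /sub_rVP[a Ea] : (root D t <= dual_act g (root D s))%MS.
  have /andP[le _] := root_span D t; apply: submx_trans le _.
  by rewrite Et submxMl.
exists a => //; apply/eqP => a0; have := root_neq0 t.
by rewrite Ea a0 scale0r eqxx.
Qed.

Lemma divided_difference_act g (Gg : g \in mg_elts G) s y f :
  pairing y (root D s) *: poly_act g (divided_difference s f) =
  pairing (g *m y) (root D (conj_refl Gg s))
    *: divided_difference (conj_refl Gg s) (poly_act g f).
Proof.
have Ug := Gunit Gg; have [a a0 Ea] := root_conj Gg s.
have -> : divided_difference (conj_refl Gg s) (poly_act g f)
          = a^-1 *: poly_act g (divided_difference s f).
  apply: divided_difference_uniq; rewrite Ea linearZ /= -scalerAr -scalerAl.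
  rewrite scalerA mulVf // scale1r -poly_act_linform -rmorphM /=.
  rewrite divided_differenceE rmorphB /=; congr (_ - _).
  rewrite -!poly_actM ?Gunit ?mg_mul ?mg_inv ?reflG //.
  by rewrite mulmxKV.
rewrite Ea /pairing /dual_act -scalemxAl mulmxA mulmxKV // [in RHS]mxE.
by rewrite scalerA mulrC mulrA mulVf ?mul1r.
Qed.

Lemma dunkl_act g y f : g \in mg_elts G ->
  poly_act g (dunkl y f) = dunkl (g *m y) (poly_act g f).
Proof.
move=> Gg; rewrite /dunkl linearN; congr (- _); rewrite [LHS](linear_sum (poly_act g)).
rewrite [RHS](reindex (conj_refl Gg)) /=; last exact/onW_bij/conj_refl_bij.
apply: eq_bigr => s _; rewrite linearZ /= -!scalerA.
rewrite divided_difference_act; congr (_ *: _).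
by apply: (param_conj D); exists g.
Qed.

Lemma refl_actE s : exists w, forall y,
  val s *m y = y + pairing y (root D s) *: w.
Proof.
have Us := Gunit (reflG s); exists (val s *m coroot D s) => y.
have E : val s = 1%:M + val s *m coroot D s *m root D s.
  by rewrite -mulmxA -root_corootE mulmxBr mulmx1 mulmxV // addrC subrK.
rewrite {1}E mulmxDl mul1mx -mulmxA; congr (_ + _).
by rewrite [root D s *m y]mx11_scalar mul_mx_scalar.
Qed.

(* Abstracting the operators d_y prevents unification from unfolding them. *)
Lemma dunklC_subproof (d : 'cV[K]_n -> {linear {mpoly K[n]} -> {mpoly K[n]}}) :
  (forall f, linear (fun y => d y f)) -> (forall y, d y 1 = 0) ->
  (forall y x f, d y (linform x * f) = linform x * d y f
    - \sum_(s : reflection G)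
       (param D s * pairing y (root D s) * pairing (coroot D s) x)
         *: poly_act (val s) f) ->
  (forall s y f, poly_act (val s) (d y f) = d (val s *m y) (poly_act (val s) f)) ->
  forall y z f, d y (d z f) = d z (d y f).
Proof.
move=> d_lin d1 dX d_act y z f.
elim/mpoly_linind: f => [|a f h IHf IHh|x f IHf].
- by rewrite !d1 !linear0.
- by rewrite !linearP IHf IHh.
rewrite !dX !linearB /= !dX IHf -!addrA; congr (_ + _).
rewrite -!opprD; congr (- _); rewrite !linear_sum /= -!big_split /=.
apply: eq_bigr => s _; rewrite !linearZ /= !d_act.
have [w Ew] := refl_actE s; rewrite !Ew.
have dE u v b g : d (u + b *: v) g = d u g + b *: d v g.
  by rewrite addrC d_lin addrC.
rewrite !dE; move: (d y _) (d z _) (d w _) => A B C.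
move: (param D s) (pairing _ _) (pairing _ _) (pairing _ _) => c Y q Z.
rewrite !scalerDr !scalerA addrAC [RHS]addrAC; congr (_ + _ *: _).
  exact: addrC.
by rewrite mulrAC [RHS]mulrAC (mulrAC c Z).
Qed.

Lemma dunklC y z f : dunkl y (dunkl z f) = dunkl z (dunkl y f).
Proof.
apply: (@dunklC_subproof (fun y => dunkl y)) => [|||s].
- exact: dunkl_is_linearl.
- exact: dunkl1.
- exact: dunkl_mull.
- by move=> *; apply: dunkl_act; apply: reflG.
Qed.

Lemma verma_opGM g h f : g \in mg_elts G -> h \in mg_elts G ->
  poly_act (g *m h) f = poly_act g (poly_act h f).
Proof. by move=> Gg Gh; apply: poly_actM; apply: Gunit. Qed.

Lemma verma_opX_linearl f : linear (fun x => linform x * f).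
Proof. by move=> a x z; rewrite linearP mulrDl scalerAl. Qed.

Lemma verma_opX_linear x : linear (fun f => linform x * f).
Proof. by move=> a f h; rewrite mulrDr scalerAr. Qed.

Lemma verma_opGX g x f : g \in mg_elts G ->
  poly_act g (linform x * f) = linform (dual_act g x) * poly_act g f.
Proof. by move=> _; rewrite rmorphM /= poly_act_linform. Qed.

Lemma verma_opYX y x f :
  dunkl y (linform x * f) - linform x * dunkl y f =
  - \sum_(s : reflection G)
     (param D s * pairing y (root D s) * pairing (coroot D s) x)
       *: poly_act (val s) f.
Proof. by rewrite dunkl_mull addrC addKr. Qed.

Definition verma_triv : cherednik_module D {mpoly K[n]} :=
  @CherednikModule K n G D {mpoly K[n]}
    (@poly_act K n) (fun x f => linform x * f) dunkl
    (fun g _ => @linearP _ _ _ _ (poly_act g))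
    verma_opX_linear dunkl_is_linear verma_opX_linearl dunkl_is_linearl
    (@poly_act1 K n) verma_opGM verma_opGX
    (fun g y f Gg => dunkl_act y f Gg)
    (fun x x' f => mulrCA (linform x) (linform x') f)
    dunklC verma_opYX.

End Dunkl.

Section Gmmn.
Variables (K : fieldType) (m n : nat).
Implicit Types g h : 'M[K]_n.

Definition monomial_mx g : bool :=
  [forall i, #|[set j | g i j != 0]| == 1%N] &&
  [forall j, #|[set i | g i j != 0]| == 1%N].

Definition in_Gmmn g : bool :=
  [&& monomial_mx g,
      [forall i, forall j, (g i j != 0) ==> (g i j ^+ m == 1)]
    & \prod_(i < n) \prod_(j < n | g i j != 0) g i j == 1].

Lemma in_GmmnP g :
  reflect (exists (s : 'S_n) (a : 'I_n -> K),
             [/\ forall i j, g i j = a i *+ (s i == j),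
                 forall i, a i ^+ m = 1, forall i, a i != 0
               & \prod_i a i = 1])
          (in_Gmmn g).
Proof.
have prodE (s : 'S_n) (a : 'I_n -> K) :
    (forall i j, g i j = a i *+ (s i == j)) -> (forall i, a i != 0) ->
  \prod_(i < n) \prod_(j < n | g i j != 0) g i j = \prod_i a i.
  move=> gE a0; apply: eq_bigr => i _.
  rewrite (big_pred1 (s i)) => [|j]; first by rewrite gE eqxx.
  rewrite gE /= (eq_sym j).
  by case: (s i == j); rewrite ?mulr1n ?mulr0n ?a0 ?eqxx.
apply: (iffP and3P) => [[/andP[/forallP gr /forallP gc] /forallP gm gp]|].
  have /fin_all_exists[s sE] i : exists k, [set j | g i j != 0] = [set k].
    exact/cards1P.
  have s0 i : g i (s i) != 0 by have /setP/(_ (s i)) := sE i; rewrite !inE eqxx.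
  have s_inj : injective s.
    move=> i j E; have /cards1P[k /setP Ek] := gc (s i).
    have := Ek i; have := Ek j; rewrite !inE s0 E s0.
    by move=> /esym/eqP -> /esym/eqP ->.
  have gE i j : g i j = g i (s i) *+ (perm s_inj i == j).
    rewrite permE; case: eqVneq => [<- //|ne]; rewrite mulr0n.
    have /setP/(_ j) := sE i; rewrite !inE (eq_sym j) (negbTE ne).
    by move/negbFE/eqP.
  exists (perm s_inj), (fun i => g i (s i)); split=> //.
    move=> i; have /forallP/(_ (s i)) := gm i.
    by rewrite s0 => /eqP.
  by rewrite -(prodE _ _ gE) //; apply/eqP.
case=> s [a [gE am a0 ap]]; have g0 i j : (g i j != 0) = (s i == j).
  by rewrite gE; case: (s i == j); rewrite ?mulr1n ?mulr0n ?a0 ?eqxx.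
split; last by rewrite (prodE _ _ gE) // ap.
  apply/andP; split; apply/forallP => i; apply/cards1P.
    by exists (s i); apply/setP => j; rewrite !inE g0 eq_sym.
  exists (s^-1%g i); apply/setP => j; rewrite !inE g0.
  by apply/eqP/eqP => [<-|->]; rewrite ?permK ?permKV.
apply/forallP => i; apply/forallP => j; rewrite g0; apply/implyP => /eqP <-.
by rewrite gE eqxx am.
Qed.

Lemma in_Gmmn1 : in_Gmmn 1%:M.
Proof.
apply/in_GmmnP; exists 1%g, (fun=> 1); split=> //.
- by move=> i j; rewrite mxE perm1.
- by move=> i; rewrite expr1n.
- by move=> i; rewrite oner_eq0.
- by rewrite big1.
Qed.

Lemma in_GmmnM g h : in_Gmmn g -> in_Gmmn h -> in_Gmmn (g *m h).
Proof.
move=> /in_GmmnP[s [a [gE am a0 ap]]] /in_GmmnP[t [b [hE bm b0 bp]]].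
apply/in_GmmnP; exists (s * t)%g, (fun i => a i * b (s i)); split.
- move=> i j; rewrite mxE (bigD1 (s i)) //= big1 => [|k ne].
    by rewrite gE eqxx hE permM addr0 mulrnAr.
  by rewrite gE eq_sym (negbTE ne) mul0r.
- by move=> i; rewrite exprMn am bm mulr1.
- by move=> i; rewrite mulf_neq0.
- by rewrite big_split /= ap mul1r -[RHS]bp [RHS](reindex_inj (@perm_inj _ s)).
Qed.

Lemma in_GmmnV g : in_Gmmn g -> exists2 h, in_Gmmn h & g *m h = 1%:M.
Proof.
move=> /in_GmmnP[s [a [gE am a0 ap]]].
exists (\matrix_(i, j) ((a (s^-1%g i))^-1 *+ (s^-1%g i == j))).
  apply/in_GmmnP; exists s^-1%g, (fun i => (a (s^-1%g i))^-1); split.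
  - by move=> i j; rewrite mxE.
  - by move=> i; rewrite exprVn am invr1.
  - by move=> i; rewrite invr_eq0.
  - rewrite prodfV -[RHS]invr1 -[in RHS]ap; congr (_^-1).
    by rewrite [RHS](reindex_inj (@perm_inj _ s^-1%g)).
apply/matrixP => i j; rewrite !mxE (bigD1 (s i)) //= big1 => [|k ne].
  by rewrite gE eqxx mulr1n !mxE permK addr0 mulrnAr mulfV ?a0.
by rewrite gE eq_sym (negbTE ne) mul0r.
Qed.

(* All n x n matrices with entries 0 or powers of xi. *)
Definition root_matrices (xi : K) : seq 'M[K]_n :=
  [seq \matrix_(i, j) oapp (fun k : 'I_m => xi ^+ k) 0 (F (i, j))
     | F : {ffun 'I_n * 'I_n -> option 'I_m}].

Definition Gmmn_elts (xi : K) : seq 'M[K]_n := filter in_Gmmn (root_matrices xi).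

Lemma mem_Gmmn_elts xi : m.-primitive_root xi ->
  forall g, (g \in Gmmn_elts xi) = in_Gmmn g.
Proof.
move=> xiP g; rewrite mem_filter; case: (boolP (in_Gmmn g)) => //= Gg.
have ex i j : exists o : option 'I_m,
    oapp (fun k : 'I_m => xi ^+ k) 0 o == g i j.
  have [/eqP g0|g0] := boolP (g i j == 0); first by exists None; rewrite /= g0.
  case/and3P: Gg => _ /forallP/(_ i)/forallP/(_ j); rewrite g0 => /eqP gm _.
  by have [k ->] := prim_rootP xiP gm; exists (Some k).
apply/imageP; exists [ffun ij => xchoose (ex ij.1 ij.2)] => //.
by apply/matrixP => i j; rewrite !mxE ffunE (eqP (xchooseP (ex i j))).
Qed.

Section Group.
Variables (xi : K) (xiP : m.-primitive_root xi).

Lemma Gmmn_unit g : g \in Gmmn_elts xi -> g \in unitmx.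
Proof.
by rewrite mem_Gmmn_elts // => /in_GmmnV[h _ /mulmx1_unit[]].
Qed.

Lemma Gmmn_one : 1%:M \in Gmmn_elts xi.
Proof. by rewrite mem_Gmmn_elts // in_Gmmn1. Qed.

Lemma Gmmn_mul g h :
  g \in Gmmn_elts xi -> h \in Gmmn_elts xi -> g *m h \in Gmmn_elts xi.
Proof. by rewrite !mem_Gmmn_elts //; apply: in_GmmnM. Qed.

Lemma Gmmn_inv g : g \in Gmmn_elts xi -> invmx g \in Gmmn_elts xi.
Proof.
rewrite !mem_Gmmn_elts // => /in_GmmnV[h Gh gh].
have [Ug _] := mulmx1_unit gh.
by have -> : invmx g = h by rewrite -[LHS]mulmx1 -gh mulKmx.
Qed.

(* The group G(m,m,n); see mem_Gmmn_elts for its membership predicate. *)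
Definition Gmmn : matgroup K n :=
  Matgroup Gmmn_unit Gmmn_one Gmmn_mul Gmmn_inv.

End Group.
End Gmmn.

(* Main.v *)
(* The p-divisibility of n makes the differences x_a^m - x_b^m singular, so D_y
   acts on the quotient of A by the ideal they generate.  With t the common
   class of the x_i^m, this quotient has the basis t^k x^e, 0 <= e_j < m, and,
   all reflections being conjugate, D_{y_i} sends t^k x^e to
     c m (k + #{j | e_i <= e_j}) t^k x^e / x_i
   whenever x_i divides t^k x^e.  Adding the squarefree monomials of degree p
   kills the basis elements with k + #{j | e_j <> 0} >= p.  A Dunkl operator can
   leave this span only when e_i = 1 and k + #{j | e_j <> 0} = p, where the
   coefficient is c m p = 0; on the remaining basis elements the coefficients
   are nonzero in K, so no positive-degree element of the quotient by the whole
   ideal is killed by all D_y. *)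
From HB Require Import structures.
Require Import Defs.
From mathcomp Require Import all_boot fingroup perm all_algebra.
From mathcomp Require Import mpoly zify.

Set Implicit Arguments.
Unset Strict Implicit.
Unset Printing Implicit Defensive.

Import GRing.Theory.
Local Open Scope ring_scope.

(** * Exponents modulo m *)

Section ExponentClasses.
Variables (n m : nat).
Implicit Types (a b c : 'X_{1..n}) (i j : 'I_n).

Definition carry a : nat := (\sum_i a i %/ m)%N.

(** Congruence of monomials modulo the differences of the [m]-th powers: the residues give the
    factor x^e of t^k x^e, and the degree then fixes k, which is [carry]. *)
Definition congm a b : bool :=
  (mdeg a == mdeg b) && [forall i, a i == b i %[mod m]].

(** Each summand is a_i / m rounded up, which makes monotonicity visible; the total is k + #{j | e_j
    <> 0} by [ceil_weightE]. *)
Definition ceil_weight a : nat := (\sum_i (a i %/ m + ~~ (m %| a i)))%N.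

Definition height i a : nat := (carry a + #|[set j | a i %% m <= a j %% m]|)%N.

Lemma congmP a b :
  reflect (mdeg a = mdeg b /\ forall i, a i = b i %[mod m]) (congm a b).
Proof.
apply: (iffP andP) => [[/eqP-> /forallP E]|[-> E]]; split=> //.
  by move=> i; apply/eqP.
by apply/forallP => i; apply/eqP.
Qed.

Lemma congm_refl a : congm a a.
Proof. exact/congmP. Qed.

Lemma congm_sym a b : congm a b = congm b a.
Proof. by apply/congmP/congmP => -[-> E]; split. Qed.

Lemma congm_trans : transitive congm.
Proof.
move=> b a c /congmP[dab E] /congmP[dbc F]; apply/congmP.
by split=> [|i]; rewrite ?dab ?E.
Qed.

Lemma congmD2r c a b : congm (a + c)%MM (b + c)%MM = congm a b.
Proof.
apply/congmP/congmP => -[E F]; split.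
- by move: E; rewrite !mdegD => /addIn.
- by move=> i; have /eqP := F i; rewrite !mnmDE eqn_modDr => /eqP.
- by rewrite !mdegD E.
- by move=> i; apply/eqP; rewrite !mnmDE eqn_modDr; apply/eqP.
Qed.

Lemma congm_mulm i j : congm (U_(i) *+ m)%MM (U_(j) *+ m)%MM.
Proof.
apply/congmP; split=> [|k]; first by rewrite !mdegMn !mdeg1.
by rewrite !mulmnE !modnMl.
Qed.

Lemma mdeg_carry a : mdeg a = (carry a * m + \sum_i a i %% m)%N.
Proof.
rewrite mdegE /carry big_distrl -big_split /=.
by apply: eq_bigr => i _; rewrite -divn_eq.
Qed.

Lemma ceil_weightE a : ceil_weight a = (carry a + #|[set j | ~~ (m %| a j)]|)%N.
Proof. by rewrite /ceil_weight big_split /= -sum1dep_card [in RHS]big_mkcond. Qed.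

Hypothesis m_gt0 : (0 < m)%N.

Lemma carry_congm a b : congm a b -> carry a = carry b.
Proof.
case/congmP=> E F; apply/eqP; rewrite -(eqn_pmul2r m_gt0).
move: E; rewrite !mdeg_carry; under [in RHS]eq_bigr do rewrite -F.
by move/addIn/eqP.
Qed.

Lemma ceil_weight_congm a b : congm a b -> ceil_weight a = ceil_weight b.
Proof.
move=> ab; rewrite !ceil_weightE (carry_congm ab).
case/congmP: ab => _ E; congr (_ + _)%N; apply: eq_card => j.
by rewrite !inE /dvdn E.
Qed.

Lemma height_congm i a b : congm a b -> height i a = height i b.
Proof.
move=> ab; rewrite /height (carry_congm ab).
case/congmP: ab => _ E; congr (_ + _)%N; apply: eq_card => j.
by rewrite !inE !E.
Qed.

Lemma leq_ceil (x y : nat) : (x <= y)%N ->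
  (x %/ m + ~~ (m %| x) <= y %/ m + ~~ (m %| y))%N.
Proof.
move=> le_xy; have [lt_q|] := ltnP (x %/ m) (y %/ m).
  by case: (m %| x)%N => /=; lia.
have le_q := leq_div2r m le_xy => ge_q.
have Eq : (x %/ m = y %/ m)%N by lia.
have Ex := divn_eq x m; have Ey := divn_eq y m; rewrite Eq in Ex *.
by rewrite leq_add2l /dvdn; case: eqP => //=; case: eqP => //=; lia.
Qed.

Lemma ceil_weight_mono a b :
  (forall i, a i <= b i)%N -> (ceil_weight a <= ceil_weight b)%N.
Proof. by move=> le_ab; apply: leq_sum => i _; apply: leq_ceil. Qed.

(** A positive exponent contributes at least 1 to the weight. Hence multiples of squarefree
    monomials of degree [p] have weight at least [p]. *)
Lemma card_le_ceil_weight (E : {set 'I_n}) a :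
  (forall i, i \in E -> 0 < a i)%N -> (#|E| <= ceil_weight a)%N.
Proof.
move=> aE; rewrite -sum1_card big_mkcond; apply: leq_sum => i _.
case: ifP => // /aE ai; case: (boolP (m %| a i)%N) => [d|_]; last by rewrite addn1.
by rewrite addn0 divn_gt0 // dvdn_leq.
Qed.

Lemma ceil_weight0 : ceil_weight 0%MM = 0%N.
Proof. by apply: big1 => i _; rewrite mnm0E div0n dvdn0. Qed.

(** When [a i] is not a multiple of [m], rounding up has already counted the next multiple. *)
Lemma ceil_weightS i a : ~~ (m %| a i)%N ->
  (ceil_weight (a + U_(i))%MM <= ceil_weight a)%N.
Proof.
move=> nd; apply: leq_sum => j _; rewrite mnmDE mnm1E.
case: eqVneq => [<-|_]; last by rewrite addn0.
rewrite nd; have E := divn_eq (a i) m; have lt := ltn_pmod (a i) m_gt0.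
have [Em|nm] := eqVneq (a i %% m).+1 m.
  have -> : (a i + true = (a i %/ m).+1 * m)%N by lia.
  by rewrite mulnK // dvdn_mull //= addn0 addn1.
have lt' : ((a i %% m).+1 < m)%N by lia.
have -> : (a i + true = a i %/ m * m + (a i %% m).+1)%N by lia.
by rewrite divnMDl // (divn_small lt') addn0; lia.
Qed.

Lemma ceil_weight_addU i a :
  (ceil_weight (a + U_(i))%MM <= (ceil_weight a).+1)%N.
Proof.
rewrite /ceil_weight (bigD1 i) //= [in X in (_ <= X)%N](bigD1 i) //=.
rewrite -addSn; apply: leq_add; last first.
  apply: leq_sum => j ne; rewrite mnmDE mnm1E.
  by rewrite eq_sym (negbTE ne) addn0.
rewrite mnmDE mnm1E eqxx addn1.
have [d|nd] := boolP (m %| a i)%N.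
  rewrite /= addn0; case/dvdnP: d => q ->; rewrite -addn1 divnMDl // mulnK //.
  (* For [m = 1] the successor of a multiple is again a multiple, so the quotient itself grows. *)
  case: (ltngtP 1 m) m_gt0 => [lt1 _|//|<- _]; last by rewrite divn1; lia.
  by rewrite divn_small //; lia.
rewrite /= addn1; have E := divn_eq (a i) m; have lt := ltn_pmod (a i) m_gt0.
have [Em|nm] := eqVneq (a i %% m).+1 m.
  have -> : ((a i).+1 = (a i %/ m).+1 * m)%N by lia.
  by rewrite mulnK // dvdn_mull //= addn0.
have lt' : ((a i %% m).+1 < m)%N by lia.
have -> : ((a i).+1 = a i %/ m * m + (a i %% m).+1)%N by lia.
by rewrite divnMDl // (divn_small lt') addn0; lia.
Qed.

(* Where D_{y_i} could leave the ideal, its coefficient is a multiple of p. *)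
Lemma height_boundary p i a : (1 < m)%N -> (ceil_weight a < p)%N ->
  (p <= ceil_weight (a + U_(i))%MM)%N -> height i (a + U_(i))%MM = p.
Proof.
(* By [ceil_weightS] the weight can cross the threshold only if [m] divides [a i]. *)
move=> m_gt1 lt_ap le_p; have [d|/ceil_weightS] := boolP (m %| a i)%N; last first.
  by move/(leq_trans le_p)/(leq_trans lt_ap); rewrite ltnn.
have -> : p = ceil_weight (a + U_(i))%MM.
  by have := ceil_weight_addU i a; lia.
(* The residue at [i] is now 1, so being at least this residue means being nonzero, and height and
   weight count the same indices. *)
rewrite ceil_weightE; congr (_ + _)%N; apply: eq_card => j; rewrite !inE.
have -> : ((a + U_(i))%MM i %% m = 1)%N.
  rewrite mnmDE mnm1E eqxx; case/dvdnP: d => q ->.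
  by rewrite modnMDl modn_small.
by rewrite lt0n.
Qed.

(** If [m] divides [a i], every index is counted, so the height is [carry + n], congruent to [carry]
    modulo [p], and 0 < [carry] <= weight < [p]. Otherwise only nonzero residues are counted, [i]
    among them, so the height lies between 1 and the weight. *)
Lemma height_ndvd p i a : (p %| n)%N -> (ceil_weight a < p)%N -> (0 < a i)%N ->
  ~~ (p %| height i a)%N.
Proof.
move=> pn lt_p ai; have Ew := ceil_weightE a.
have [d|nd] := boolP (m %| a i)%N.
  have -> : height i a = (carry a + n)%N.
    congr (_ + _)%N; rewrite -[RHS]card_ord; apply: eq_card => j.
    by rewrite !inE (eqP d).
  rewrite dvdn_addl //; apply/negP => /dvdn_leq le.
  have : (0 < carry a)%N.
    rewrite /carry (bigD1 i) //= ltn_addr // divn_gt0 //.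
    exact: dvdn_leq.
  by move=> w0; have := le w0; lia.
apply/negP => /dvdn_leq le.
have c0 : (0 < #|[set j | a i %% m <= a j %% m]|)%N.
  by apply/card_gt0P; exists i; rewrite inE.
have c1 : (#|[set j | a i %% m <= a j %% m]| <= #|[set j | ~~ (m %| a j)]|)%N.
  apply: subset_leq_card; apply/subsetP => j; rewrite !inE => h.
  by rewrite /dvdn -lt0n; apply: leq_trans h; rewrite lt0n.
by have := le (ltn_addl _ c0); rewrite /height; lia.
Qed.

End ExponentClasses.

(** * The ideal *)

Section GeneratedIdeal.
Variables (A : comNzRingType) (S : A -> Prop).

Lemma ideal_generated0 : ideal_generated S 0.
Proof. by exists [::] => //; rewrite big_nil. Qed.

Lemma ideal_generatedD f g :
  ideal_generated S f -> ideal_generated S g -> ideal_generated S (f + g).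
Proof.
move=> [l lS ->] [k kS ->]; exists (l ++ k); last by rewrite big_cat.
by move=> q; rewrite mem_cat => /orP[/lS|/kS].
Qed.

Lemma ideal_generatedM f g : ideal_generated S f -> ideal_generated S (g * f).
Proof.
move=> [l lS ->]; exists [seq (g * q.1, q.2) | q <- l].
  by move=> q /mapP[r /lS Sr ->].
by rewrite big_map mulr_sumr; apply: eq_bigr => q _ /=; rewrite mulrA.
Qed.

Lemma ideal_generated_gen f : S f -> ideal_generated S f.
Proof.
move=> Sf; exists [:: (1, f)]; last by rewrite big_seq1 mul1r.
by move=> q; rewrite inE => /eqP ->.
Qed.

Lemma ideal_generatedN f : ideal_generated S f -> ideal_generated S (- f).
Proof. by rewrite -mulN1r; apply: ideal_generatedM. Qed.

Lemma ideal_generated_sum (I : Type) (r : seq I) (P : pred I) (F : I -> A) :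
  (forall i, P i -> ideal_generated S (F i)) ->
  ideal_generated S (\sum_(i <- r | P i) F i).
Proof.
by move=> SF; apply: big_ind => //;
  [exact: ideal_generated0 | exact: ideal_generatedD].
Qed.

Lemma ideal_generated_ind (P : A -> Prop) :
  P 0 -> (forall f g, P f -> P g -> P (f + g)) ->
  (forall q g, S g -> P (q * g)) -> forall f, ideal_generated S f -> P f.
Proof.
move=> P0 PD PS f [l lS ->]; rewrite big_seq; apply: big_ind => // q /lS.
exact: PS.
Qed.

Definition eq_mod_ideal f g := ideal_generated S (f - g).

Lemma eq_mod_ideal_refl f : eq_mod_ideal f f.
Proof. by rewrite /eq_mod_ideal subrr; apply: ideal_generated0. Qed.

Lemma eq_mod_ideal_sym f g : eq_mod_ideal f g -> eq_mod_ideal g f.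
Proof. by rewrite /eq_mod_ideal -(opprB f); apply: ideal_generatedN. Qed.

Lemma eq_mod_ideal_trans g f h :
  eq_mod_ideal f g -> eq_mod_ideal g h -> eq_mod_ideal f h.
Proof.
by move=> fg gh; have := ideal_generatedD fg gh; rewrite addrA subrK.
Qed.

Lemma eq_mod_idealM f f' g g' :
  eq_mod_ideal f f' -> eq_mod_ideal g g' -> eq_mod_ideal (f * g) (f' * g').
Proof.
move=> Ef Eg; rewrite /eq_mod_ideal.
have -> : f * g - f' * g' = g * (f - f') + f' * (g - g').
  by rewrite !mulrBr addrA (mulrC g f) (mulrC g f') subrK.
by apply: ideal_generatedD; apply: ideal_generatedM.
Qed.

Lemma eq_mod_idealX f g k : eq_mod_ideal f g -> eq_mod_ideal (f ^+ k) (g ^+ k).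
Proof.
move=> E; elim: k => [|k IH]; first exact: eq_mod_ideal_refl.
by rewrite !exprS; apply: eq_mod_idealM.
Qed.

Lemma eq_mod_ideal_prod (I : Type) (r : seq I) (F G : I -> A) :
  (forall i, eq_mod_ideal (F i) (G i)) ->
  eq_mod_ideal (\prod_(i <- r) F i) (\prod_(i <- r) G i).
Proof.
move=> E; apply: (big_ind2 eq_mod_ideal) => //; first exact: eq_mod_ideal_refl.
by move=> *; apply: eq_mod_idealM.
Qed.

End GeneratedIdeal.

(** * Subsets of prescribed size *)

Lemma exists_superset_card (T : finType) (S : {set T}) k :
  (#|S| <= k <= #|T|)%N -> exists2 E : {set T}, S \subset E & #|E| = k.
Proof.
elim: k => [|k IH] /andP[le_S le_T].
  by exists S => //; apply/eqP; rewrite -leqn0.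
move: le_S; rewrite leq_eqVlt => /predU1P[<-|lt_S]; first by exists S.
have [|E SE cE] := IH; first by rewrite -ltnS lt_S ltnW.
have /card_gt0P[x] : (0 < #|~: E|)%N.
  by have := cardsC E; rewrite cE; lia.
rewrite inE => xE; exists (x |: E); last by rewrite cardsU1 xE cE.
exact: subset_trans SE (subsetUr _ _).
Qed.

(** If [S] is too large, a superset of its complement is chosen and complemented. This serves to
    pick [p] variables that use as many nonzero residues as possible. *)
Lemma exists_comparable_card (T : finType) (S : {set T}) k : (k <= #|T|)%N ->
  exists2 E : {set T}, #|E| = k & S \subset E \/ E \subset S.
Proof.
move=> le_k; have [le_S|lt_S] := leqP #|S| k.
  have [|E SE cE] := @exists_superset_card _ S k; first by rewrite le_S.
  by exists E; first exact: cE; left.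
have cS := cardsC S.
have [|E SE cE] := @exists_superset_card _ (~: S) (#|T| - k).
  by rewrite leq_subr andbT; lia.
exists (~: E); first by have := cardsC E; lia.
by right; rewrite subCset.
Qed.

(** * Coordinates modulo the differences of [m]-th powers *)

Section ClassSums.
Variables (K : fieldType) (n m : nat).
Implicit Types (a b c : 'X_{1..n}) (f g : {mpoly K[n]}).

(* The coordinates of f modulo the ideal generated by the differences of the
   m-th powers of the variables. *)
Definition class_sum b f : K :=
  \sum_(a : 'X_{1..n < (mdeg b).+1} | congm m a b) f@_a.

Lemma class_sum_is_linear b : linear_for *%R (class_sum b).
Proof.
move=> x f g; rewrite /class_sum mulr_sumr -big_split /=.
by apply: eq_bigr => a _; rewrite linearP.
Qed.

HB.instance Definition _ b :=
  GRing.isLinear.Build K {mpoly K[n]} K _ (class_sum b) (class_sum_is_linear b).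

Lemma class_sumX b a : class_sum b 'X_[a] = (congm m a b)%:R.
Proof.
rewrite /class_sum; case: (boolP (congm m a b)) => ab; last first.
  apply: big1 => c cb; rewrite mcoeffX; case: eqP => // E.
  by rewrite E cb in ab.
(* The degree bound in [class_sum] only makes the sum finite: congruent exponents have equal degree,
   so none is lost. *)
have lt : (mdeg a < (mdeg b).+1)%N by case/congmP: ab => ->.
rewrite (bigD1 (BMultinom lt)) //= mcoeffX eqxx big1 ?addr0 // => c /andP[_ ne].
by rewrite mcoeffX; case: eqP => // E; case/eqP: ne; apply: val_inj.
Qed.

(** Both sides are linear in [f], so an identity between coordinates has to be checked on monomials
    only. *)
Lemma class_sum_intertwine (F : {linear {mpoly K[n]} -> {mpoly K[n]}}) b b' x :
  (forall a, class_sum b (F 'X_[a]) = x * (congm m a b')%:R) ->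
  forall f, class_sum b (F f) = x * class_sum b' f.
Proof.
move=> E; elim/mpolyind => [|y a f _ _ IH]; first by rewrite !linear0 mulr0.
by rewrite !linearP /= IH E class_sumX mulrDr (mulrCA x).
Qed.

Lemma class_sumE b f :
  class_sum b f = \sum_(a <- msupp f) f@_a * (congm m a b)%:R.
Proof.
rewrite {1}[f]mpolyE linear_sum; apply: eq_bigr => a _.
by rewrite linearZ /= class_sumX.
Qed.

End ClassSums.

(** * Linear equations for the ideal *)

Section Ideal.
Variables (K : fieldType) (n m p : nat).
Hypotheses (m_gt0 : (0 < m)%N) (n_gt0 : (0 < n)%N) (le_pn : (p <= n)%N).
Implicit Types (a b c : 'X_{1..n}) (f g : {mpoly K[n]}).

Definition ideal_gens g : Prop :=
  (exists a b : 'I_n, (a < b)%N /\ g = 'X_a ^+ m - 'X_b ^+ m) \/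
  (exists E : {set 'I_n}, #|E| = p /\ g = \prod_(i in E) 'X_i).

Local Notation J := (ideal_generated ideal_gens).

(** Linear equations that cut out the ideal, see [idealP]; grading and Dunkl operators can be tested
    on them one coordinate at a time. *)
Definition low_vanishing f : Prop :=
  forall b, (ceil_weight m b < p)%N -> class_sum m b f = 0.

Lemma prod_setX (E : {set 'I_n}) :
  \prod_(i in E) 'X_i = 'X_[mesym1 E] :> {mpoly K[n]}.
Proof.
rewrite mprodXE; congr 'X_[_]; apply/mnmP => i; rewrite mnm_sumE mnmE.
rewrite big_mkcond (bigD1 i) //= mnm1E eqxx big1 ?addn0 ?if_same => [|j ne].
  by case: ifP.
by rewrite mnm1E (negbTE ne) if_same.
Qed.

Lemma power_diff_ideal i j : J ('X_i ^+ m - 'X_j ^+ m).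
Proof.
case: (ltngtP i j) => [ij|ji|/val_inj->].
- by apply: ideal_generated_gen; left; exists i, j.
- rewrite -opprB; apply: ideal_generatedN; apply: ideal_generated_gen.
  by left; exists j, i.
- by rewrite subrr; apply: ideal_generated0.
Qed.

(** It suffices to treat monomial multiples of generators. For a difference of [m]-th powers the two
    resulting monomials are congruent and cancel in every class sum; for a squarefree monomial of
    degree [p] the result has weight at least [p]. *)
Lemma ideal_low_vanishing f : J f -> low_vanishing f.
Proof.
move=> Jf b lt_b; elim/ideal_generated_ind: Jf => [|f1 g f10 g0|q g Sg].
- by rewrite linear0.
- by rewrite linearD /= f10 g0 addr0.
rewrite [q]mpolyE mulr_suml linear_sum big1 // => c _.
rewrite -scalerAl linearZ /=; apply/eqP; rewrite mulf_eq0; apply/orP; right.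
apply/eqP; case: Sg => [[i [j [_ ->]]]|[E [cE ->]]].
  rewrite !mpolyXn mulrBr -!mpolyXD linearB /= !class_sumX; apply/eqP.
  rewrite subr_eq0; apply/eqP; congr (_%:R); congr nat_of_bool.
  have ij : congm m (c + U_(i) *+ m)%MM (c + U_(j) *+ m)%MM.
    by rewrite ![(c + _)%MM]addmC congmD2r congm_mulm.
  apply/idP/idP; apply: congm_trans => //.
  by rewrite congm_sym.
rewrite prod_setX -mpolyXD class_sumX; case: (boolP (congm _ _ _)) => // cb.
move: lt_b; rewrite -(ceil_weight_congm m_gt0 cb) -cE ltnNge card_le_ceil_weight //.
by move=> i iE; rewrite mnmDE mnmE iE addn1.
Qed.

(** Normal form of a class: the residues are kept, and t^k is represented by a power of the first
    variable. *)
Definition reduced a : 'X_{1..n} :=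
  ([multinom a i %% m | i < n] + U_(Ordinal n_gt0) *+ (m * carry m a))%MM.

Lemma reduced_congm a : congm m (reduced a) a.
Proof.
apply/congmP; split.
  rewrite mdegD mdegMn mdeg1 mul1n (mdeg_carry m a) addnC mulnC mdegE.
  by congr (_ + _)%N; apply: eq_bigr => i _; rewrite mnmE.
move=> i; rewrite mnmDE mnmE mulmnE mnm1E mulnCA -modnDmr modnMr addn0.
by rewrite modn_mod.
Qed.

Lemma reducedE a b : congm m a b -> reduced a = reduced b.
Proof.
move=> ab; rewrite /reduced (carry_congm m_gt0 ab); congr (_ + _)%MM.
by apply/mnmP => i; rewrite !mnmE; case/congmP: ab.
Qed.

Lemma reduced_mod_ideal a : eq_mod_ideal ideal_gens 'X_[a] 'X_[reduced a].
Proof.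
set z := Ordinal n_gt0.
have -> : 'X_[a] =
    (\prod_i 'X_i ^+ (a i %% m)) * \prod_i ('X_i ^+ m) ^+ (a i %/ m)
    :> {mpoly K[n]}.
  rewrite mpolyXE_id -big_split /=; apply: eq_bigr => i _.
  by rewrite -exprM -exprD addnC mulnC -divn_eq.
have -> : 'X_[reduced a] =
    (\prod_i 'X_i ^+ (a i %% m)) * \prod_(i < n) ('X_z ^+ m) ^+ (a i %/ m)
    :> {mpoly K[n]}.
  rewrite prodrXr -/(carry m a) mpolyXD -exprM mpolyXn; congr (_ * _).
  by rewrite mpolyXE_id; apply: eq_bigr => i _; rewrite mnmE.
apply: eq_mod_idealM; first exact: eq_mod_ideal_refl.
apply: eq_mod_ideal_prod => i; apply: eq_mod_idealX.
exact: power_diff_ideal.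
Qed.

Lemma congm_mod_ideal a b : congm m a b ->
  eq_mod_ideal ideal_gens 'X_[a] 'X_[b].
Proof.
move=> ab; apply: eq_mod_ideal_trans (reduced_mod_ideal a) _.
by rewrite (reducedE ab); apply/eq_mod_ideal_sym/reduced_mod_ideal.
Qed.

(** The class of [b] has a representative divisible by a squarefree monomial of degree [p]: the
    [m]-th powers contained in [b] can be moved to variables with residue zero. *)
Lemma high_monomial_ideal b : (p <= ceil_weight m b)%N -> J 'X_[b].
Proof.
rewrite ceil_weightE; set S := [set i | _] => le_p.
have [|E cE SE] := @exists_comparable_card _ S p; first by rewrite card_ord.
(* Either [E] lies in [S] and nothing is missing, or [S] lies in [E] and [p - #|S|] indices are
   missing, which [le_p] bounds by [carry m b]. *)
have le_T : (#|E :\: S| <= carry m b)%N.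
  by have [s|/[dup] s /subset_leq_card] := SE;
    rewrite cardsD ?(setIidPr s) ?(setIidPl s) cE; lia.
(* Each missing index receives one [m]-th power, and the first variable takes those left over. *)
pose b' := ([multinom b i %% m | i < n] + mesym1 (E :\: S) *+ m
            + U_(Ordinal n_gt0) *+ (m * (carry m b - #|E :\: S|)))%MM.
have b'b : congm m b' b.
  apply/congmP; split.
    rewrite !mdegD !mdegMn mdeg1 mul1n mdeg_mesym1 (mdeg_carry m b) mdegE.
    under eq_bigr do rewrite mnmE.
    by rewrite -addnA addnC mulnC -mulnDr subnKC // mulnC.
  move=> i; rewrite !mnmDE mnmE !mulmnE mnm1E [(_ * (m * _))%N]mulnCA -modnDmr.
  by rewrite modnMr addn0 -modnDmr modnMl addn0 modn_mod.
have -> : 'X_[b] = ('X_[b] - 'X_[b']) + 'X_[b' - mesym1 E] * 'X_[mesym1 E]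
    :> {mpoly K[n]}.
  rewrite -mpolyXD submK ?subrK //; apply/mnm_lepP => i.
  rewrite mnmE !mnmDE mnmE !mulmnE mnmE !inE.
  case: (boolP (i \in E)) => //= iE; rewrite andbT.
  have [d|nd] := boolP (m %| b i)%N; first by rewrite /= mul1n -addnA addnCA ltn_addr.
  by rewrite -addnA ltn_addr // lt0n.
apply: ideal_generatedD; first by apply: congm_mod_ideal; rewrite congm_sym.
apply: ideal_generatedM; apply: ideal_generated_gen; right.
by exists E; rewrite prod_setX.
Qed.

(** Modulo the ideal [f] equals the combination [g] of normal forms. The coefficient of [g] at a
    normal form is the class sum of [f] there, so only monomials of weight at least [p] survive. *)
Lemma low_vanishing_ideal f : low_vanishing f -> J f.
Proof.
move=> low; pose g : {mpoly K[n]} := \sum_(a <- msupp f) f@_a *: 'X_[reduced a].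
rewrite -[f](subrK g); apply: ideal_generatedD.
  rewrite [X in X - _]mpolyE -sumrB; apply: ideal_generated_sum => a _.
  rewrite -scalerBr -mul_mpolyC; apply: ideal_generatedM.
  exact: reduced_mod_ideal.
rewrite [g]mpolyE; apply: ideal_generated_sum => b _.
have [->|gb] := eqVneq g@_b 0; first by rewrite scale0r; apply: ideal_generated0.
rewrite -mul_mpolyC; apply/ideal_generatedM/high_monomial_ideal.
rewrite leqNgt; apply/negP => /low f0; case/eqP: gb.
have gE : g@_b = \sum_(a <- msupp f) f@_a * (reduced a == b)%:R.
  rewrite /g raddf_sum /=; apply: eq_bigr => a _.
  by rewrite mcoeffZ mcoeffX.
(* An exponent that is not its own normal form never occurs in [g]. *)
have [Eb|ne] := eqVneq b (reduced b); last first.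
  rewrite gE big1 // => a _; case: eqP => [E|]; rewrite ?mulr0 //.
  by case/eqP: ne; rewrite -E; apply: reducedE; rewrite congm_sym reduced_congm.
rewrite gE; apply: etrans f0; rewrite class_sumE; apply: eq_bigr => a _; congr (_ * _%:R).
congr nat_of_bool; apply/eqP/idP => [<-|/reducedE ->] //.
by rewrite congm_sym reduced_congm.
Qed.

Lemma idealP f : J f <-> low_vanishing f.
Proof. by split; [exact: ideal_low_vanishing | exact: low_vanishing_ideal]. Qed.

(** Each class lies in one degree, so the projection multiplies every class sum by 0 or 1. *)
Lemma low_vanishing_pihomog d f :
  low_vanishing f -> low_vanishing (pihomog mdeg d f).
Proof.
move=> low b lt_b; have -> : class_sum m b (pihomog mdeg d f) =
    (mdeg b == d)%:R * class_sum m b f.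
  elim/mpolyind: f {low} => [|x a f _ _ IH]; first by rewrite !linear0 mulr0.
  rewrite !linearP /= IH mulrDr pihomogX mulrCA; congr (_ * _ + _).
  rewrite class_sumX; have [ab|nab] := boolP (congm m a b).
    have [dab _] := congmP _ _ _ ab; rewrite /= dab.
    by case: ifP => _; rewrite ?class_sumX ?ab ?mulr1 // linear0.
  by rewrite mulr0; case: ifP; rewrite ?class_sumX ?(negbTE nab) ?linear0.
by rewrite low // mulr0.
Qed.

End Ideal.

(** * Reflections of G(m,m,n) *)

Section MonomialMatrices.
Variables (K : fieldType) (n : nat).
Implicit Types (i j k l : 'I_n) (x y z : K) (s t : 'S_n) (a b : 'I_n -> K).

Lemma tperm_fix i j k : k != i -> k != j -> tperm i j k = k.
Proof. by rewrite !(eq_sym k); apply: tpermD. Qed.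

Definition scaled_perm_mx (s : 'S_n) (a : 'I_n -> K) : 'M[K]_n :=
  \matrix_(k, l) (a k *+ (s k == l)).

Lemma scaled_perm_mxM s t a b :
  scaled_perm_mx s a *m scaled_perm_mx t b =
  scaled_perm_mx (s * t)%g (fun k => a k * b (s k)).
Proof.
apply/matrixP => k l; rewrite !mxE (bigD1 (s k)) //= big1 => [|r ne].
  by rewrite !mxE eqxx addr0 permM mulr1n mulrnAr.
by rewrite !mxE eq_sym (negbTE ne) mul0r.
Qed.

Lemma eq_scaled_perm_mx s t a b : s =1 t -> a =1 b ->
  scaled_perm_mx s a = scaled_perm_mx t b.
Proof. by move=> st ab; apply/matrixP => k l; rewrite !mxE st ab. Qed.

Definition two_point i j x y k : K :=
  if k == i then x else if k == j then y else 1.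

Lemma two_point_prod i j x y : i != j -> \prod_k two_point i j x y k = x * y.
Proof.
move=> ij; rewrite (bigD1 i) //= (bigD1 j) 1?eq_sym //= big1 => [|k /andP[ki kj]].
  by rewrite /two_point eqxx (eq_sym j) (negbTE ij) eqxx mulr1.
by rewrite /two_point (negbTE ki) (negbTE kj).
Qed.

Lemma two_pointX m i j x y : x ^+ m = 1 -> y ^+ m = 1 ->
  forall k, two_point i j x y k ^+ m = 1.
Proof.
by move=> xm ym k; rewrite /two_point; do 2?case: ifP; rewrite ?expr1n.
Qed.

(* The reflection s_{ij}^k is refl_mx i j (xi ^+ k). *)
Definition refl_mx i j z : 'M[K]_n :=
  scaled_perm_mx (tperm i j) (two_point i j z z^-1).

Definition refl_root i j z : 'rV[K]_n := delta_mx 0 i - z *: delta_mx 0 j.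

Definition refl_coroot i j z : 'cV[K]_n := delta_mx i 0 - z^-1 *: delta_mx j 0.

Lemma refl_mx_root i j z : i != j -> z != 0 ->
  1%:M - refl_mx i j z = refl_coroot i j z *m refl_root i j z.
Proof.
move=> ij z0; apply/matrixP => k l; rewrite !mxE big_ord1 !mxE !eqxx !andbT /=.
rewrite /two_point; case: tpermP => [->|->|/eqP ki /eqP kj].
- rewrite eqxx (negbTE ij) mulr0 subr0 mul1r (eq_sym i l) (eq_sym j l).
  by rewrite mulr_natr.
- rewrite (eq_sym j i) (negbTE ij) eqxx sub0r mulr1 (eq_sym i l) (eq_sym j l).
  by rewrite mulNr mulrBr mulKf // opprB mulr_natr.
by rewrite (negbTE ki) (negbTE kj) mulr0 subr0 mul0r subrr.
Qed.

Lemma refl_mxK i j z : i != j -> z != 0 -> refl_mx i j z *m refl_mx i j z = 1%:M.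
Proof.
move=> ij z0; rewrite scaled_perm_mxM tperm2; apply/matrixP => k l.
rewrite !mxE perm1 /two_point; have [->|ki] := eqVneq k i.
  by rewrite tpermL eq_sym (negbTE ij) eqxx mulfV.
have [->|kj] := eqVneq k j; first by rewrite tpermR eqxx mulVf.
by rewrite tperm_fix // (negbTE ki) (negbTE kj) mulr1.
Qed.

Lemma refl_mx_is_reflection i j z : i != j -> z != 0 ->
  is_reflection (refl_mx i j z).
Proof.
move=> ij z0; rewrite /is_reflection eqn_leq refl_mx_root // mulmx_max_rank /=.
rewrite lt0n mxrank_eq0; apply/eqP => /matrixP/(_ i i).
rewrite !mxE big_ord1 !mxE !eqxx !andbT (negbTE ij) !mulr0 !subr0 mulr1.
by move/eqP; rewrite oner_eq0.
Qed.

Lemma refl_mx_inj i j j' z z' : i != j -> i != j' -> z != 0 -> z' != 0 ->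
  refl_mx i j z = refl_mx i j' z' -> j = j' /\ z = z'.
Proof.
move=> ij ij' z0 z0' /matrixP/(_ i j); rewrite !mxE /two_point !eqxx !tpermL.
rewrite eqxx mulr1n; case: eqVneq => [->|_] E; first by split.
by rewrite E eqxx in z0.
Qed.

Lemma exists_perm2 i j i' j' : i != j -> i' != j' ->
  exists s : 'S_n, s i' = i /\ s j' = j.
Proof.
move=> ij ij'; exists (tperm i' i * tperm (tperm i' i j') j)%g.
rewrite !permM (tpermL i'); split; last by rewrite tpermL.
apply: tperm_fix => //; move: ij'; rewrite -(inj_eq (@perm_inj _ (tperm i' i))).
by rewrite tpermL.
Qed.

End MonomialMatrices.

(** * Classification and conjugacy of the reflections, and the Dunkl sum over them *)

Section Reflections.
Variables (K : fieldType) (m n : nat) (xi : K).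
Hypotheses (m_gt0 : (0 < m)%N) (hxi : m.-primitive_root xi).
Local Notation G := (Gmmn n hxi).
Implicit Types (i j k l : 'I_n) (x y z : K) (s t : reflection G).

Lemma unity_neq0 z : z ^+ m = 1 -> z != 0.
Proof.
move=> zm; apply/eqP => z0; move: zm; rewrite z0 expr0n eqn0Ngt m_gt0 => /eqP.
by rewrite eq_sym oner_eq0.
Qed.

Lemma scaled_perm_mx_mem (s : 'S_n) (a : 'I_n -> K) :
  (forall k, a k ^+ m = 1) -> \prod_k a k = 1 ->
  scaled_perm_mx s a \in mg_elts G.
Proof.
move=> am ap; rewrite mem_Gmmn_elts //; apply/in_GmmnP; exists s, a.
by split=> // [k l|k]; [rewrite mxE | apply: unity_neq0].
Qed.

Lemma refl_mx_mem i j z : i != j -> z ^+ m = 1 ->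
  refl_mx i j z \in [seq g <- mg_elts G | is_reflection g].
Proof.
move=> ij zm; have z0 := unity_neq0 zm.
rewrite mem_filter refl_mx_is_reflection //= scaled_perm_mx_mem //.
  by apply: two_pointX; rewrite // exprVn zm invr1.
by rewrite two_point_prod // mulfV.
Qed.

Lemma Gmmn_act_var g : g \in mg_elts G -> exists (s : 'S_n) (a : 'I_n -> K),
  (forall k, a k ^+ m = 1) /\
  forall k, poly_act g 'X_k = a k *: 'X_(s k) :> {mpoly K[n]}.
Proof.
move=> Gg; have := mg_inv Gg; rewrite mem_Gmmn_elts //.
case/in_GmmnP=> s [a [gE am _ _]]; exists s, a; split=> // k.
rewrite poly_actX /dual_act -rowE /linform (bigD1 (s k)) //= big1 => [|j ne].
  by rewrite addr0 mxE gE eqxx mulr1n.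
by rewrite mxE gE eq_sym (negbTE ne) scale0r.
Qed.

Lemma refl_mx_act_var i j z k : i != j -> z ^+ m = 1 ->
  poly_act (refl_mx i j z) 'X_k =
  two_point i j z z^-1 k *: 'X_(tperm i j k) :> {mpoly K[n]}.
Proof.
move=> ij zm; have z0 := unity_neq0 zm.
have Einv : invmx (refl_mx i j z) = refl_mx i j z.
  have [U _] := mulmx1_unit (refl_mxK ij z0).
  by apply: (can_inj (mulKmx U)); rewrite mulmxV // refl_mxK.
rewrite poly_actX /dual_act Einv -rowE /linform.
rewrite (bigD1 (tperm i j k)) //= big1 => [|l ne].
  by rewrite addr0 !mxE eqxx mulr1n.
by rewrite !mxE eq_sym (negbTE ne) scale0r.
Qed.

(** The ratio [t] has to be realised with total product 1. A third index can absorb the extra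
    factor; without one, a square root of [t] is split over the two indices. *)
Lemma exists_scaling i j (t : K) : i != j -> t ^+ m = 1 -> (2 < n)%N || odd m ->
  exists a : 'I_n -> K,
    [/\ forall k, a k ^+ m = 1, \prod_k a k = 1 & a j = t * a i].
Proof.
move=> ij tm; have t0 := unity_neq0 tm; have [n2 _|_ /= m_odd] := ltnP 2 n.
  have /card_gt0P[l] : (0 < #|~: [set i; j]|)%N.
    by have := cardsC [set i; j]; rewrite cards2 ij card_ord; lia.
  rewrite !inE negb_or => /andP[li lj]; exists (two_point j l t t^-1).
  rewrite two_point_prod 1?eq_sym // mulfV //; split=> //.
    by apply: two_pointX; rewrite // exprVn tm invr1.
  by rewrite /two_point eqxx (negbTE ij) eq_sym (negbTE li) mulr1.
(* As [m] is odd, the halving is exact and [y] squares to t^(m+1) = t. *)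
pose y := t ^+ m.+1./2; have yy : y * y = t.
  rewrite -exprD addnn; have -> : (m.+1./2.*2 = m.+1)%N by lia.
  by rewrite exprS tm mulr1.
have ym : y ^+ m = 1 by rewrite exprAC tm expr1n.
have y0 := unity_neq0 ym; exists (two_point i j y^-1 y).
rewrite two_point_prod // mulVf //; split=> //.
  by apply: two_pointX; rewrite // exprVn ym invr1.
by rewrite /two_point eqxx eq_sym (negbTE ij) eqxx -yy mulfK.
Qed.

(** A permutation matches the index pairs and [exists_scaling] adjusts the root of unity. For n = 2
    and even m the group is dihedral with two classes of reflections, whence the last hypothesis. *)
Lemma refl_mx_conj i j i' j' z z' : i != j -> i' != j' ->
  z ^+ m = 1 -> z' ^+ m = 1 -> (2 < n)%N || odd m ->
  exists2 g, g \in mg_elts G &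
    refl_mx i' j' z' = g *m refl_mx i j z *m invmx g.
Proof.
move=> ij ij' zm zm' hn; have z0 := unity_neq0 zm; have z0' := unity_neq0 zm'.
have [|a [am ap aE]] := @exists_scaling i' j' (z / z') ij' _ hn.
  by rewrite exprMn exprVn zm zm' invr1 mulr1.
have [s [si sj]] := exists_perm2 ij ij'.
have Gg := scaled_perm_mx_mem s am ap.
exists (scaled_perm_mx s a) => //; have U := mg_unit Gg.
apply: (can_inj (mulmxK U)); rewrite mulmxKV // !scaled_perm_mxM.
apply: eq_scaled_perm_mx => k.
  by rewrite !permM -si -sj -tpermJ permJ.
rewrite /two_point -si -sj !(inj_eq perm_inj).
have [->|ki] := eqVneq k i'.
  by rewrite tpermL aE mulrA mulrC; congr (_ * _); rewrite mulrC divfK.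
have [->|kj] := eqVneq k j'.
  by rewrite tpermR aE; apply: (mulIf z0); rewrite divfK // mulrC mulrA.
by rewrite tperm_fix // mulrC.
Qed.

Variable D : cherednik_datum G.

(** The inverse of [s] is monomial, with permutation [t] and entries [a], and 1 minus it is the
    rank-one product [u *m v]. Comparing entries forces [t] to exchange [i] with another index and
    to be trivial elsewhere. *)
Lemma reflection_refl_mx s i : Defs.root D s 0 i != 0 ->
  exists j z, [/\ i != j, z ^+ m = 1 & val s = refl_mx i j z].
Proof.
set v := Defs.root D s; set u := coroot D s => vi.
have /in_GmmnP[t [a [hE am a0 ap]]] : in_Gmmn m (invmx (val s)).
  rewrite -(mem_Gmmn_elts hxi) //; exact: (mg_inv (reflG s)).
have E k l : (k == l)%:R - a k *+ (t k == l) = u k 0 * v 0 l.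
  have /matrixP/(_ k l) := root_corootE D s.
  by rewrite !mxE big_ord1 => <-; rewrite -hE.
have row1 k : u k 0 = 0 -> t k = k /\ a k = 1.
  move=> uk; have := E k (t k); rewrite uk mul0r eqxx mulr1n => /eqP.
  rewrite subr_eq0 => /eqP ak; have := a0 k; rewrite -ak.
  by case: (eqVneq k (t k)) => [Ek _|_]; rewrite ?eqxx.
(* If [t] fixed [i], all other rows would be those of the identity; the product condition then gives
   [a i = 1], so [s] would be the identity. *)
have [ti|ti] := eqVneq (t i) i.
  have : a i = 1.
    rewrite -[LHS]mulr1 -[RHS]ap (bigD1 i) //=; congr (_ * _); apply/esym.
    apply: big1 => k ki; case: (row1 k) => //; apply/eqP.
    have := E k i; rewrite (negbTE ki) sub0r -{1}ti (inj_eq perm_inj) (negbTE ki).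
    by rewrite mulr0n oppr0 => /esym/eqP; rewrite mulf_eq0 (negbTE vi) orbF.
  move=> ai; have ui : u i 0 = 0.
    apply/eqP; have := E i i; rewrite ti eqxx ai mulr1n subrr => /esym/eqP.
    by rewrite mulf_eq0 (negbTE vi) orbF.
  have u0 : u = 0.
    apply/colP => k; rewrite [RHS]mxE; have [->//|ki] := eqVneq k i.
    have := E k i; rewrite (negbTE ki) sub0r -{1}ti (inj_eq perm_inj) (negbTE ki).
    rewrite mulr0n oppr0 => /esym/eqP; rewrite mulf_eq0 (negbTE vi) orbF.
    by move/eqP.
  have /eqP := root_corootE D s; rewrite -/u u0 mul0mx subr_eq0 => /eqP Es.
  have := refl_rank s; rewrite -(invmxK (val s)) -Es invmx1 subrr mxrank0.
  by [].
set j := t i; have ij : i != j by rewrite eq_sym.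
have tj : t j != j by rewrite (inj_eq perm_inj).
(* The 2 x 2 minor of [u *m v] on the indices [i], [j] vanishes; this yields [t j = i] and
   [a j = (a i)^-1]. *)
have ui : u i 0 * v 0 i = 1 by rewrite -E eqxx (negbTE ti) subr0.
have uj : u j 0 * v 0 j = 1 by rewrite -E eqxx (negbTE tj) subr0.
have uij : u i 0 * v 0 j = - a i by rewrite -E (negbTE ij) eqxx sub0r.
have uji : u j 0 * v 0 i * a i = - 1.
  by rewrite -[a i]opprK -uij mulrN (mulrC (u i 0)) mulrACA uj mul1r mulrC ui.
have tji : t j = i.
  apply/eqP; apply: contraT => ne; move/eqP: uji.
  by rewrite -E (eq_sym j) (negbTE ij) (negbTE ne) subrr mul0r eq_sym oppr_eq0 oner_eq0.
have aj : a j = (a i)^-1.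
  apply: (mulIf (a0 i)); rewrite mulVf //; apply: oppr_inj.
  by rewrite -uji -E tji eqxx (eq_sym j) (negbTE ij) sub0r mulNr.
exists j, (a i); split=> //.
have U : val s \in unitmx by apply: mg_unit (reflG s).
have Ez := refl_mxK ij (a0 i).
have -> : refl_mx i j (a i) = invmx (invmx (val s)); last by rewrite invmxK.
have -> : invmx (val s) = refl_mx i j (a i).
  apply/matrixP => k l; rewrite hE mxE /two_point.
  have [->|ki] := eqVneq k i; first by rewrite tpermL.
  have [->|kj] := eqVneq k j; first by rewrite tpermR tji aj.
  rewrite tperm_fix //; case: (row1 k) => [|-> ->//].
  apply/eqP; have := E k i; rewrite (negbTE ki) -{1}tji (inj_eq perm_inj).
  by rewrite (negbTE kj) subr0 => /esym/eqP; rewrite mulf_eq0 (negbTE vi) orbF.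
have [U' _] := mulmx1_unit Ez.
by apply: (can_inj (mulKmx U')); rewrite mulmxV.
Qed.

Lemma reflection_conj s t : (2 < n)%N || odd m -> Defs.conjugate s t.
Proof.
move=> hn.
have refl (r : reflection G) : exists i j z,
    [/\ i != j, z ^+ m = 1 & val r = refl_mx i j z].
  have /rV0Pn[i ri] := root_neq0 D r.
  by have [j [z h]] := reflection_refl_mx ri; exists i, j, z.
have [i [j [z [ij zm Es]]]] := refl s; have [i' [j' [z' [ij' zm' Et]]]] := refl t.
by rewrite /Defs.conjugate Es Et; apply: refl_mx_conj.
Qed.

(** The root is chosen only up to a scalar. Comparing row [i] of the two rank-one factorizations of
    1 - s identifies that scalar as the [i]-th coordinate of the root. *)
Lemma root_refl_mx s i j z : i != j -> z ^+ m = 1 -> val s = refl_mx i j z ->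
  Defs.root D s 0 i != 0 /\
  Defs.root D s = Defs.root D s 0 i *: refl_root i j z.
Proof.
move=> ij zm Es; have z0 := unity_neq0 zm.
have Einv : invmx (refl_mx i j z) = refl_mx i j z.
  have [U _] := mulmx1_unit (refl_mxK ij z0).
  by apply: (can_inj (mulKmx U)); rewrite mulmxV // refl_mxK.
have := root_corootE D s; rewrite Es Einv refl_mx_root // => /matrixP E.
set v := Defs.root D s in E *; set u := coroot D s in E.
have Ei l : refl_root i j z 0 l = u i 0 * v 0 l.
  have := E i l; rewrite !mxE !big_ord1 => <-.
  by rewrite [refl_coroot _ _ _ _ _]mxE !mxE !eqxx (negbTE ij) mulr0 subr0 mul1r.
have uvi : u i 0 * v 0 i = 1.
  by rewrite -Ei !mxE !eqxx (negbTE ij) mulr0 subr0.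
split; first by apply/eqP => vi; move/eqP: uvi; rewrite vi mulr0 eq_sym oner_eq0.
by apply/rowP => l; rewrite [RHS]mxE Ei mulrCA mulrA uvi mul1r.
Qed.

(** The factor (y_i, alpha_s) cancels the normalisation of the root, leaving division by x_i - z
    x_j. *)
Lemma divided_difference_refl_mx s i j z (f q : {mpoly K[n]}) :
  i != j -> z ^+ m = 1 -> val s = refl_mx i j z ->
  ('X_i - z *: 'X_j) * q = f - poly_act (refl_mx i j z) f ->
  Defs.root D s 0 i *: divided_difference D s f = q.
Proof.
move=> ij zm Es Eq; have [vi vE] := root_refl_mx ij zm Es.
have -> : divided_difference D s f = (Defs.root D s 0 i)^-1 *: q.
  apply: divided_difference_uniq; rewrite Es -Eq {1}vE linearZ /=.
  rewrite -scalerAl -scalerAr scalerA mulfV // scale1r.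
  by rewrite /refl_root linearB linearZ /= !linform_delta.
by rewrite scalerA mulfV // scale1r.
Qed.

(** Reflections whose root does not involve x_i drop out of D_{y_i}; the others are the s_{ij}^k,
    each obtained from exactly one pair (j, k). *)
Lemma dunkl_refl_mx (c : K) i (f : {mpoly K[n]})
    (q : 'I_n -> 'I_m -> {mpoly K[n]}) :
  (forall s, param D s = c) ->
  (forall j (k : 'I_m), i != j -> ('X_i - xi ^+ k *: 'X_j) * q j k =
     f - poly_act (refl_mx i j (xi ^+ k)) f) ->
  dunkl D (delta_mx i 0) f = - (c *: \sum_(j | i != j) \sum_(k < m) q j k).
Proof.
move=> cE qE; rewrite /dunkl; congr (- _).
have pE s : pairing (delta_mx i 0) (Defs.root D s) = Defs.root D s 0 i.
  by rewrite /pairing -colE mxE.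
rewrite (bigID (fun s => Defs.root D s 0 i != 0)) /= addrC big1 ?add0r => [|s].
  2: by rewrite negbK pE => /eqP ->; rewrite mulr0 scale0r.
rewrite scaler_sumr; under [RHS]eq_bigr do rewrite scaler_sumr.
rewrite pair_big_dep /=.
have xim (k : 'I_m) : (xi ^+ k) ^+ m = 1 by rewrite exprAC (prim_expr_order hxi) expr1n.
(* With no second index both sums are empty; otherwise some reflection is available as a default
   value. *)
have [j0 ij0|no_j] := pickP (fun j => i != j); last first.
  rewrite !big_pred0 // => [[j k]|s]; first by rewrite /= no_j.
  apply/negbTE; rewrite negbK; apply: contraT => /reflection_refl_mx[j [z [ij _ _]]].
  by rewrite no_j in ij.
pose s0 : reflection G := SeqSub (refl_mx_mem ij0 (expr1n K m)).
(* The default [s0] only makes [h] total; on pairs with j <> i the matrix is a reflection of the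
   group, by [refl_mx_mem]. *)
pose h (jk : 'I_n * 'I_m) : reflection G := insubd s0 (refl_mx i jk.1 (xi ^+ jk.2)).
have hE jk : i != jk.1 -> val (h jk) = refl_mx i jk.1 (xi ^+ jk.2).
  by move=> ij; rewrite /h val_insubd (refl_mx_mem ij (xim _)).
pose A := [set jk : 'I_n * 'I_m | i != jk.1].
have h_inj : {in A &, injective h}.
  move=> [j k] [j' k']; rewrite !inE /= => ij ij' /(congr1 val).
  rewrite !hE //= => /refl_mx_inj [] //; try exact/unity_neq0/xim.
  move=> <- /eqP; rewrite (eq_prim_root_expr hxi) !modn_small // => /eqP kk'.
  by congr (_, _); apply: val_inj.
transitivity (\sum_(s in h @: A) c *: (Defs.root D s 0 i *: divided_difference D s f)).
  apply: eq_big => [s|s _]; last by rewrite cE pE scalerA.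
  apply/idP/imsetP => [/reflection_refl_mx[j [z [ij zm Es]]]|[[j k]]].
    have [k Ek] := prim_rootP hxi zm; exists (j, k); first by rewrite inE.
    by apply: val_inj; rewrite hE // Es Ek.
  rewrite inE /= => ij ->.
  by have [] := root_refl_mx ij (xim k) (hE (j, k) ij).
rewrite big_imset //=; apply: eq_big => [[j k]|[j k]]; rewrite inE /= ?andbT // => ij.
by rewrite (divided_difference_refl_mx ij (xim k) (hE (j, k) ij) (qE j k ij)).
Qed.

End Reflections.

(** * Dunkl operators on monomials *)

Lemma sum_unity_root (K : fieldType) m (w : K) : w ^+ m = 1 ->
  \sum_(k < m) w ^+ k = m%:R * (w == 1)%:R.
Proof.
move=> wm; have [->|w1] := eqVneq w 1.
  rewrite mulr1 (eq_bigr (fun=> 1)) => [|k _]; last by rewrite expr1n.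
  by rewrite sumr_const card_ord.
apply: (mulfI (x := w - 1)); first by rewrite subr_eq0.
by rewrite -subrX1 wm subrr !mulr0.
Qed.

(** * Counting multiples of [m] *)

Section DivisionCounting.
Variable m : nat.
Hypothesis m_gt0 : (0 < m)%N.

(** The sum on the right is d / m rounded up. In the induction on [d], a new multiple appears
    exactly when x and x + d have the same residue. *)
Lemma count_multiples x d :
  ((x + d) %/ m + (x %% m < (x + d) %% m) =
   x %/ m + \sum_(r < d) (m %| r))%N.
Proof.
elim: d => [|d IH]; first by rewrite addn0 ltnn big_ord0.
rewrite big_ord_recr /= addnA -IH -addnA addnS.
set y := (x + d)%N; have lty := ltn_pmod y m_gt0; have ltx := ltn_pmod x m_gt0.
have -> : (m %| d)%N = (x %% m == y %% m)%N.
  by rewrite -[in LHS](addKn x d) eq_sym eqn_mod_dvd // leq_addr.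
have Ey := divn_eq y m; have [Em|nm] := eqVneq (y %% m).+1 m.
  have -> : (y.+1 = (y %/ m).+1 * m)%N by lia.
  by rewrite mulnK // modnMl ltn0; lia.
have lt' : ((y %% m).+1 < m)%N by lia.
have -> : (y.+1 = y %/ m * m + (y %% m).+1)%N by lia.
by rewrite divnMDl // modnMDl (divn_small lt') (modn_small lt'); lia.
Qed.

(** The companion with d / m rounded down, obtained by dropping the multiple r = 0 from
    [count_multiples]. *)
Lemma count_multiplesS x d :
  ((x + d) %/ m = x %/ m + ((x + d) %% m < x %% m) +
   \sum_(r < d) (m %| r.+1))%N.
Proof.
have := count_multiples x d.+1; rewrite big_ord_recl dvdn0 /= => E.
have := count_multiples x d; have : (\sum_(r < d.+1) (m %| r) =
  \sum_(r < d) (m %| r) + (m %| d))%N by rewrite big_ord_recr.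
rewrite big_ord_recl dvdn0 /=.
have -> : (m %| d)%N = (x %% m == (x + d) %% m)%N.
  by rewrite -[in LHS](addKn x d) eq_sym eqn_mod_dvd // leq_addr.
rewrite /bump /=; under eq_bigr do rewrite add1n.
by lia.
Qed.

End DivisionCounting.

Lemma congm_shift n m (h : 'X_{1..n}) (i j : 'I_n) u r : (m %| r)%N ->
  congm m (h + (U_(i) *+ u + U_(j) *+ r))%MM (h + U_(i) *+ (u + r))%MM.
Proof.
case/dvdnP=> q ->; apply/congmP; split=> [|k].
  by rewrite !mdegD !mdegMn !mdeg1 !mul1n.
rewrite !mnmDE !mulmnE mulnDr !mulnA !addnA.
by rewrite -[LHS]modnDmr -[RHS]modnDmr !modnMl.
Qed.

(** * Dunkl operators in class-sum coordinates *)

Section DunklClassSums.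
Variables (K : fieldType) (m n : nat) (xi : K).
Hypotheses (m_gt0 : (0 < m)%N) (hxi : m.-primitive_root xi).
Local Notation G := (Gmmn n hxi).
Implicit Types (i j : 'I_n) (a b : 'X_{1..n}).

Lemma refl_mx_act_sym i j (z : K) a : i != j -> z ^+ m = 1 -> a i = a j ->
  poly_act (refl_mx i j z) 'X_[a] = 'X_[a].
Proof.
move=> ij zm aij; have z0 := unity_neq0 m_gt0 zm.
rewrite {1}mpolyXE_id rmorph_prod /=.
under eq_bigr do rewrite rmorphXn /= (refl_mx_act_var m_gt0 _ ij zm) exprZn.
rewrite scaler_prod.
have -> : \prod_k two_point i j z z^-1 k ^+ a k = 1.
  rewrite (bigD1 i) //= (bigD1 j) 1?eq_sym //= big1 => [|k /andP[ki kj]].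
    by rewrite /two_point eqxx eq_sym (negbTE ij) eqxx aij mulr1 -exprMn mulfV ?expr1n.
  by rewrite /two_point (negbTE ki) (negbTE kj) expr1n.
rewrite scale1r [RHS](mpolyXE _ (tperm i j)); apply: eq_bigr => k _.
by congr (_ ^+ _); case: tpermP => [->|->|//].
Qed.

(* (x - y) / m rounded upwards, whichever of x and y is larger. *)
Definition ceil_diff (x y : nat) : K :=
  (x %/ m)%:R - (y %/ m)%:R + (y %% m < x %% m)%:R.

(** Splitting off a power of x_i or x_j leaves a monomial fixed by the reflection, so the quotient
    is a geometric sum. Summing over [k] keeps only terms whose exponent of xi^k is divisible by
    [m]; these all lie in one class, and counting them gives [ceil_diff]. *)
Lemma refl_quotient_monomial i j a : i != j ->
  exists q : 'I_m -> {mpoly K[n]},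
    (forall k : 'I_m, ('X_i - xi ^+ k *: 'X_j) * q k =
       'X_[a] - poly_act (refl_mx i j (xi ^+ k)) 'X_[a]) /\
    forall b, class_sum m b (\sum_k q k) =
      m%:R * ceil_diff (a i) (a j) * (congm m a (b + U_(i))%MM)%:R.
Proof.
move=> ij; have xim (k : 'I_m) : (xi ^+ k) ^+ m = 1.
  by rewrite exprAC (prim_expr_order hxi) expr1n.
have [le_ji|lt_ij] := leqP (a j) (a i).
  pose d := (a i - a j)%N; pose h := (a - U_(i) *+ d)%MM.
  have aE : a = (h + U_(i) *+ d)%MM.
    rewrite submK //; apply/mnm_lepP => k; rewrite mulmnE mnm1E.
    by case: eqVneq => [<-|]; rewrite ?mul1n ?mul0n // leq_subr.
  have h_sym : h i = h j.
    rewrite !mnmBE !mulmnE !mnm1E eqxx (negbTE ij).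
    by rewrite mul1n mul0n subn0 subKn.
  exists (fun k => \sum_(r < d) (xi ^+ k) ^+ r *:
    'X_[h + (U_(i) *+ (d.-1 - r) + U_(j) *+ r)]); split=> [k|b].
    rewrite aE mpolyXD -mpolyXn rmorphM rmorphXn /= refl_mx_act_sym //.
    rewrite (refl_mx_act_var m_gt0 _ ij (xim k)) tpermL /two_point eqxx.
    rewrite -mulrBr subrXX mulrCA; congr (_ * _); rewrite mulr_sumr.
    apply: eq_bigr => r _; rewrite !mpolyXD -!mpolyXn exprZn.
    by rewrite -!scalerAr.
  rewrite exchange_big linear_sum /=.
  rewrite (eq_bigr (fun r : 'I_d => m%:R * (m %| r)%:R *
    (congm m a (b + U_(i))%MM)%:R)) => [|r _].
    rewrite -mulr_suml -mulr_sumr -natr_sum; congr (_ * _ * _).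
    have := count_multiples m_gt0 (a j) d; rewrite subnKC //.
    move/(congr1 (fun k => k%:R : K)).
    by rewrite !natrD /ceil_diff addrAC => ->; rewrite addrC addKr.
  rewrite -scaler_suml linearZ /= class_sumX.
  (* The sum over [k] of (xi^r)^k is [m] if [m] divides [r] and 0 otherwise. *)
  under eq_bigr do rewrite exprAC.
  rewrite sum_unity_root; last by rewrite exprAC (prim_expr_order hxi) expr1n.
  rewrite -(prim_order_dvd hxi) -!mulrA; congr (_ * _).
  have [mr|] := boolP (m %| r)%N; last by rewrite !mul0r.
  rewrite !mul1r; congr (_%:R); congr nat_of_bool.
  have Xa : congm m (h + (U_(i) *+ (d.-1 - r) + U_(j) *+ r) + U_(i))%MM a.
    have -> : (h + (U_(i) *+ (d.-1 - r) + U_(j) *+ r) + U_(i) =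
               h + (U_(i) *+ (d - r) + U_(j) *+ r))%MM.
      apply/mnmP => k; rewrite !(mnmDE, mulmnE) mnm1E.
      by have := ltn_ord r; case: (i == k); lia.
    apply: congm_trans (congm_shift _ _ _ _ mr) _.
    by rewrite subnK ?[in X in congm _ _ X]aE ?congm_refl // ltnW.
  by rewrite -(congmD2r m U_(i)%MM); apply/idP/idP; apply: congm_trans;
    rewrite // congm_sym.
pose d := (a j - a i)%N; pose h := (a - U_(j) *+ d)%MM.
have le_ij := ltnW lt_ij.
have aE : a = (h + U_(j) *+ d)%MM.
  rewrite submK //; apply/mnm_lepP => k; rewrite mulmnE mnm1E.
  by case: eqVneq => [<-|]; rewrite ?mul1n ?mul0n // leq_subr.
have h_sym : h i = h j.
  rewrite !mnmBE !mulmnE !mnm1E eqxx eq_sym (negbTE ij).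
  by rewrite mul1n mul0n subn0 subKn.
(* With z = xi^k, extracting z^(-d) turns x_j^d - (x_i / z)^d into a difference divisible by x_i - z
   x_j. The coefficients become z^(-(r+1)), so this case counts multiples among the r + 1, with a
   minus sign. *)
exists (fun k => - \sum_(r < d) (xi ^+ k)^-1 ^+ r.+1 *:
  'X_[h + (U_(j) *+ (d.-1 - r) + U_(i) *+ r)]); split=> [k|b].
  have z0 := unity_neq0 m_gt0 (xim k).
  rewrite aE mpolyXD -mpolyXn rmorphM rmorphXn /= refl_mx_act_sym //.
  rewrite (refl_mx_act_var m_gt0 _ ij (xim k)) tpermR /two_point.
  rewrite eq_sym (negbTE ij) eqxx -mulrBr mulrN -mulNr opprB.
  have -> : 'X_j ^+ d - ((xi ^+ k)^-1 *: 'X_i) ^+ d =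
      (xi ^+ k)^-1 ^+ d *: ((xi ^+ k *: 'X_j) ^+ d - 'X_i ^+ d) :> {mpoly K[n]}.
    by rewrite !exprZn scalerBr scalerA -exprMn mulVf // expr1n scale1r.
  rewrite subrXX scalerAr mulrCA; congr (_ * _); rewrite scaler_sumr mulr_sumr.
  apply: eq_bigr => r _; rewrite !mpolyXD -!mpolyXn exprZn.
  rewrite -scalerAl scalerA -scalerAr; congr (_ *: _).
  have -> : (xi ^- k) ^+ d = (xi ^- k) ^+ (d.-1 - r) * (xi ^- k) ^+ r.+1.
    by rewrite -exprD; congr (_ ^+ _); have := ltn_ord r; lia.
  by rewrite mulrAC -exprMn mulVf // expr1n mul1r.
rewrite sumrN exchange_big linearN linear_sum /=.
rewrite (eq_bigr (fun r : 'I_d => m%:R * (m %| r.+1)%:R *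
  (congm m a (b + U_(i))%MM)%:R)) => [|r _].
  rewrite -mulr_suml -mulr_sumr -natr_sum -mulNr -mulrN; congr (_ * _ * _).
  have := count_multiplesS m_gt0 (a i) d; rewrite subnKC //.
  move/(congr1 (fun k => k%:R : K)).
  rewrite !natrD /ceil_diff => ->.
  by rewrite !opprD !addrA subrr add0r addrAC addNr add0r.
rewrite -scaler_suml linearZ /= class_sumX.
under eq_bigr do rewrite -exprVn exprAC.
have xiV : ((xi^-1) ^+ r.+1) ^+ m = 1.
  by rewrite exprAC exprVn (prim_expr_order hxi) invr1 expr1n.
rewrite sum_unity_root // exprVn invr_eq1.
rewrite -(prim_order_dvd hxi) -!mulrA; congr (_ * _).
have [mr|] := boolP (m %| r.+1)%N; last by rewrite !mul0r.
rewrite !mul1r; congr (_%:R); congr nat_of_bool.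
have Xa : congm m (h + (U_(j) *+ (d.-1 - r) + U_(i) *+ r) + U_(i))%MM a.
  have -> : (h + (U_(j) *+ (d.-1 - r) + U_(i) *+ r) + U_(i) =
             h + (U_(j) *+ (d.-1 - r) + U_(i) *+ r.+1))%MM.
    apply/mnmP => k; rewrite !(mnmDE, mulmnE) mnm1E.
    by case: (i == k); lia.
  apply: congm_trans (congm_shift _ _ _ _ mr) _.
  have -> : (d.-1 - r + r.+1 = d)%N by have := ltn_ord r; lia.
  by rewrite -aE congm_refl.
by rewrite -(congmD2r m U_(i)%MM); apply/idP/idP; apply: congm_trans;
  rewrite // congm_sym.
Qed.

(** The term j = i is zero and may be added. The quotients then sum to n q_i - [carry] and the
    comparisons to n minus the count in [height]; both multiples of n vanish in K. *)
Lemma sum_ceil_diff i a : n%:R = 0 :> K ->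
  \sum_(j | i != j) ceil_diff (a i) (a j) = - (height m i a)%:R.
Proof.
move=> n0; transitivity (\sum_j ceil_diff (a i) (a j)).
  rewrite [RHS](bigD1 i) //= /ceil_diff subrr ltnn addr0 add0r.
  by apply: eq_bigl => j; rewrite eq_sym.
rewrite big_split sumrB /= sumr_const card_ord -(mulr_natr _ n) n0 mulr0 sub0r.
rewrite -!natr_sum /height natrD opprD; congr (_ + _).
apply/eqP; rewrite -addr_eq0 -natrD -sum1dep_card.
rewrite [X in (_ + X)%N]big_mkcond -big_split /= (eq_bigr (fun=> 1%N)) => [|j _].
  by rewrite sum_nat_const card_ord muln1 n0.
by case: ltnP.
Qed.

(** Monomials suffice by [class_sum_intertwine]. The sign of the Dunkl operator cancels that of
    [sum_ceil_diff], and the height depends only on the class. *)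
Lemma class_sum_dunkl (D : cherednik_datum G) (c : K) i b (f : {mpoly K[n]}) :
  n%:R = 0 :> K -> (forall s, param D s = c) ->
  class_sum m b (dunkl D (delta_mx i 0) f) =
  c * m%:R * (height m i (b + U_(i))%MM)%:R * class_sum m (b + U_(i))%MM f.
Proof.
move=> n0 cE; apply: (class_sum_intertwine (F := dunkl D (delta_mx i 0))) => a.
have /fin_all_exists[q qP] (j : 'I_n) : exists q : 'I_m -> {mpoly K[n]}, i != j ->
    (forall k : 'I_m, ('X_i - xi ^+ k *: 'X_j) * q k =
       'X_[a] - poly_act (refl_mx i j (xi ^+ k)) 'X_[a]) /\
    forall b, class_sum m b (\sum_k q k) =
      m%:R * ceil_diff (a i) (a j) * (congm m a (b + U_(i))%MM)%:R.
  have [ij|] := boolP (i != j); last by exists (fun=> 0).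
  by have [q qP] := refl_quotient_monomial a ij; exists q.
rewrite /= (dunkl_refl_mx m_gt0 cE (q := q)) => [|j k ij]; last by case: (qP j ij).
rewrite linearN linearZ linear_sum /=.
under eq_bigr => j ij do have [_ ->] := qP j ij.
rewrite -mulr_suml -mulr_sumr sum_ceil_diff //.
have [ab|_] := boolP (congm _ _ _); last by rewrite !mulr0 oppr0.
by rewrite (height_congm m_gt0 _ ab) !mulr1 !mulrN opprK mulrA.
Qed.

End DunklClassSums.

(** * Maximality *)

Section GradedSubmodules.
Variables (K : fieldType) (n : nat) (G : matgroup K n) (D : cherednik_datum G).

Lemma eq_proper_graded_submodule (M : cherednik_module D {mpoly K[n]})
    (N N' : {mpoly K[n]} -> Prop) :
  (forall f, N f <-> N' f) ->
  proper_graded_submodule M N -> proper_graded_submodule M N'.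
Proof.
move=> NN' [[N0 NL NG NX NY] Nh [f Nf]]; split; last by exists f => /NN'.
  split=> [|a u v /NN' Nu /NN' Nv|g u Gg /NN' Nu|x u /NN' Nu|y u /NN' Nu]; apply/NN'.
  - exact: N0.
  - exact: NL.
  - exact: NG.
  - exact: NX.
  - exact: NY.
by move=> d u /NN' Nu; apply/NN'/Nh.
Qed.


Lemma linear_coord (V : lmodType K) (F : 'cV[K]_n -> V) y : linear F ->
  F y = \sum_i y i 0 *: F (delta_mx i 0).
Proof.
move=> L; have F0 : F 0 = 0 by rewrite -(addNr 0) -scaleN1r L scaleN1r addNr.
have yE : y = \sum_i y i 0 *: delta_mx i 0.
  by rewrite {1}[y]matrix_sum_delta; apply: eq_bigr => i _; rewrite big_ord1.
by rewrite {1}yE; elim/big_rec2: _ => // i z w _ <-; rewrite L.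
Qed.

End GradedSubmodules.

(** * The ideal as the largest proper graded submodule *)

Section MaximalSubmodule.
Variables (K : fieldType) (p m n : nat) (xi : K).
Hypotheses (hp : p \in [pchar K]) (m_gt1 : (1 < m)%N) (hpm : ~~ (p %| m)%N).
Hypotheses (hxi : m.-primitive_root xi) (n_gt0 : (0 < n)%N) (hpn : (p %| n)%N).
Local Notation G := (Gmmn n hxi).
Variable D : cherednik_datum G.
Implicit Types (f : {mpoly K[n]}) (b : 'X_{1..n}).

Let m_gt0 : (0 < m)%N := ltnW m_gt1.
Let p_prime : prime p := pcharf_prime hp.
Let le_pn : (p <= n)%N := dvdn_leq n_gt0 hpn.
Let n_eq0 : n%:R = 0 :> K.
Proof. by apply/eqP; rewrite -(dvdn_pcharf hp). Qed.

(** If n <= 2, then p <= n gives p = 2, and p not dividing m makes m odd; so [reflection_conj]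
    always applies. *)
Lemma reflections_conj (s t : reflection G) : Defs.conjugate s t.
Proof.
apply: (reflection_conj m_gt0 D); have [//|n2] := ltnP 2 n.
have p_gt1 := prime_gt1 p_prime; have p2 : p = 2%N by have := le_pn; lia.
by move: hpm; rewrite p2 dvdn2 negbK.
Qed.

Lemma param_const : generic D ->
  exists2 c, c != 0 & forall s, param D s = c.
Proof.
move=> gen; have n_gt1 := leq_trans (prime_gt1 p_prime) le_pn.
have ij : Ordinal n_gt0 != Ordinal n_gt1 by [].
pose s0 : reflection G := SeqSub (refl_mx_mem m_gt0 hxi ij (expr1n K m)).
exists (param D s0) => [|s]; last exact/(param_conj D)/reflections_conj.
(* Genericity for a single class, applied to the polynomial X, excludes the value 0. *)
apply/eqP => c0; have /eqP : 'X_ord0 = 0 :> {mpoly K[1]}.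
  apply: (gen 1%N (fun=> s0)) => [i j _|u|]; first by rewrite !ord1.
    by rewrite mcoeffX; exists (U_(ord0) == u)%MM.
  by rewrite mevalXU.
by move/eqP/(congr1 (mcoeff U_(ord0))); rewrite mcoeffXU eqxx mcoeff0 => /eqP;
  rewrite oner_eq0.
Qed.

(** Each variable goes to an [m]-th root of unity times a variable, so generators go to scalar
    multiples of generators, up to the order of the indices in a difference. *)
Lemma ideal_poly_act g f : g \in mg_elts G ->
  ideal_generated (ideal_gens m p) f ->
  ideal_generated (ideal_gens m p) (poly_act g f).
Proof.
move=> Gg Jf; have [s [a [am gX]]] := Gmmn_act_var Gg.
elim/ideal_generated_ind: Jf => [|f1 f2 J1 J2|q h Sh].
- by rewrite rmorph0; apply: ideal_generated0.
- by rewrite rmorphD; apply: ideal_generatedD.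
rewrite rmorphM /=; apply: ideal_generatedM; case: Sh => [[i [j [_ ->]]]|[E [cE ->]]].
  rewrite rmorphB !rmorphXn /= !gX !exprZn !am !scale1r.
  exact: power_diff_ideal.
rewrite rmorph_prod /= (eq_bigr _ (fun i _ => gX i)) scaler_prod -mul_mpolyC.
apply/ideal_generatedM/ideal_generated_gen; right; exists (s @: E).
rewrite card_imset ?cE; last exact: perm_inj.
by rewrite big_imset //= => i j _ _; apply: perm_inj.
Qed.

(** The coordinate of D_{y_i} f at [b] is a multiple of that of f at b + U_i. Either the latter
    weight is still below [p], or the coefficient is divisible by [p] by [height_boundary]. *)
Lemma low_vanishing_dunkl (c : K) y f : (forall s, param D s = c) ->
  low_vanishing m p f -> low_vanishing m p (dunkl D y f).
Proof.
move=> cE low b lt_b.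
rewrite (linear_coord y (dunkl_is_linearl D f)) linear_sum big1 // => i _.
rewrite linearZ /= (class_sum_dunkl m_gt0 _ _ _ n_eq0 cE).
have [lt_bi|le_p] := ltnP (ceil_weight m (b + U_(i))%MM) p.
  by rewrite low // !mulr0.
by rewrite (height_boundary m_gt0 m_gt1 lt_b le_p) (pcharf0 hp) mulr0 mul0r mulr0.
Qed.

(** Stability under the group and under multiplication is seen on the ideal, stability under Dunkl
    operators and the grading on coordinates. The polynomial 1 is outside because the class of
    exponent 0 has weight 0. *)
Lemma low_vanishing_proper : generic D ->
  proper_graded_submodule (verma_triv D) (low_vanishing m p).
Proof.
move=> /param_const[c _ cE]; split=> [|d f|].
- split=> [b _|x u v lu lv b lt_b|g u Gg|x u|y u] /=.
  + by rewrite linear0.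
  + by rewrite linearP /= lu // lv // mulr0 addr0.
  + move/(low_vanishing_ideal m_gt0 n_gt0 le_pn) => Ju.
    by apply: (ideal_low_vanishing m_gt0); apply: ideal_poly_act.
  + move/(low_vanishing_ideal m_gt0 n_gt0 le_pn) => Ju.
    by apply: (ideal_low_vanishing m_gt0); apply: ideal_generatedM.
  + exact: low_vanishing_dunkl cE.
- exact: low_vanishing_pihomog.
exists 1 => /(_ 0%MM); rewrite ceil_weight0 prime_gt0 // => /(_ isT)/eqP.
by rewrite -mpolyX0 class_sumX congm_refl oner_eq0.
Qed.

Lemma pihomog0_class_sum f : pihomog mdeg 0 f = class_sum m 0%MM f *: 1.
Proof.
elim/mpolyind: f => [|x a f _ _ E]; first by rewrite !linear0 scale0r.
rewrite linearP /= E class_sum_is_linear scalerDl -scalerA.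
congr (_ *: _ + _); rewrite pihomogX /= class_sumX mdeg_eq0.
have [->|a0] := eqVneq a 0%MM; first by rewrite congm_refl scale1r mpolyX0.
rewrite (_ : congm _ _ _ = false) ?scale0r //.
by apply/negP => /congmP[]; rewrite mdeg0 => /eqP; rewrite mdeg_eq0 (negbTE a0).
Qed.

(** Induction on the degree of [b]: a Dunkl operator lowers the degree, and on classes of weight
    below [p] its coefficient is nonzero by [height_ndvd]. *)
Lemma proper_graded_low_vanishing (N : {mpoly K[n]} -> Prop) f : generic D ->
  proper_graded_submodule (verma_triv D) N -> N f -> low_vanishing m p f.
Proof.
move=> /param_const[c c0 cE] [[N0 NL NG NX NY] Nh [f0 Nf0]] Nf b.
move Ed: (mdeg b) => d; elim: d b Ed f Nf => [|d IH] b Ed f Nf lt_b.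
  have -> : b = 0%MM by apply/eqP; rewrite -mdeg_eq0 Ed.
  (* In degree 0 a nonzero class sum is a nonzero constant term, which puts 1, and with it every
     polynomial, into [N]. *)
  apply/eqP; apply: contraT => cf0; case: Nf0.
  have N1 : N 1.
    have := NL (class_sum m 0%MM f)^-1 _ _ (Nh 0%N _ Nf) N0.
    by rewrite pihomog0_class_sum scalerA mulVf // scale1r addr0.
  elim/mpoly_linind: f0 => [|x g h Ng Nh'|x g Ng]; first exact: N1.
    exact: NL.
  exact: NX.
have [i bi] : exists i, (0 < b i)%N.
  apply/existsP; apply: contraT; rewrite negb_exists => /forallP b0.
  move: Ed; rewrite mdegE big1 // => i _; apply/eqP.
  by have := b0 i; rewrite -eqn0Ngt.
have bE : b = (b - U_(i) + U_(i))%MM.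
  rewrite submK //; apply/mnm_lepP => k; rewrite mnm1E.
  by case: eqVneq => [<-|].
have Edb : mdeg (b - U_(i))%MM = d.
  by apply: succn_inj; rewrite -Ed [in RHS]bE mdegD mdeg1 addn1.
have lt_b' : (ceil_weight m (b - U_(i))%MM < p)%N.
  apply: leq_ltn_trans lt_b; apply: ceil_weight_mono => // k.
  by rewrite mnmBE leq_subr.
(* The induction hypothesis applies to D_{y_i} f, with x_i a variable occurring in [b]; removing x_i
   does not raise the weight. *)
have /eqP := IH _ Edb _ (NY (delta_mx i 0) _ Nf) lt_b'.
rewrite /= (class_sum_dunkl m_gt0 _ _ _ n_eq0 cE) -bE.
rewrite !mulf_eq0 (negbTE c0) -!(dvdn_pcharf hp) (negbTE hpm).
by rewrite (negbTE (height_ndvd m_gt0 hpn lt_b bi)) => /eqP.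
Qed.

End MaximalSubmodule.

Theorem proposition6p2 (K : fieldType) (p m n : nat) (xi : K)
    (hp : p \in [pchar K]) (hm : (1 < m)%N) (hpm : ~~ (p %| m)%N)
    (hxi : m.-primitive_root xi) (hn : (1 <= n)%N) (hpn : (p %| n)%N)
    (D : cherednik_datum (Gmmn n hxi)) (hD : generic D)
    (J : {mpoly K[n]} -> Prop) :
  maximal_proper_graded_submodule (verma_triv D) J <->
  (forall f : {mpoly K[n]}, J f <->
     ideal_generated (fun g : {mpoly K[n]} =>
       (exists a b : 'I_n, (a < b)%N /\ g = 'X_a ^+ m - 'X_b ^+ m) \/
       (exists E : {set 'I_n}, #|E| = p /\ g = \prod_(i in E) 'X_i)) f).
Proof.
have lowP := idealP (K := K) (ltnW hm) hn (dvdn_leq hn hpn).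
have low_proper := low_vanishing_proper hp hm hpm hn hpn hD.
have low_max N f := @proper_graded_low_vanishing _ _ _ _ _ hp hm hpm _ hn hpn _ N f hD.
(* Every proper graded submodule lies in [low_vanishing m p], itself one; a maximal one must
   therefore equal it, and conversely it is maximal. *)
split=> [[Jp Jmax] f|JE].
  split=> [Jf|/lowP]; first exact/lowP/(low_max _ _ Jp).
  by apply: Jmax low_proper _ f => g; apply: low_max.
have JlowE f : low_vanishing m p f <-> J f.
  by split=> [/lowP/JE|/JE/lowP].
split; first exact: eq_proper_graded_submodule JlowE low_proper.
by move=> N Np _ f Nf; apply/JlowE/(low_max N f Np).
Qed.
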